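(* Let $1<\rho_l<\rho_u<\infty$, $c>0$ and $\alpha\ge 0$ be constants. Let $n,k\to\infty$ in parallel while $\rho_l<\log n/\log k<\rho_u$, and let $(A_k)$ be a sequence of $k\times k$ matrices with $A_k\in\mathcal{A}_{c,\alpha}$. Then for any constant $\gamma>7+\alpha$, asymptotically almost surely the spectral gap of the random transition probability matrix $H_n(A_k)$ satisfies $$\lambda(H_n(A_k))\ \ge\ \frac{k}{n\log^\gamma k}.$$
   Context: Notation: $\log^\gamma k=(\log k)^\gamma$. ''Asymptotically almost surely'' means with probability tending to $1$ in the stated limit. Spectral gap: for an irreducible doubly stochastic matrix $A$, $\lambda(A)=\min\{1-|\mu| : \mu\ne 1 \text{ is an eigenvalue of } A\}$. Class $\mathcal{A}_{c,\alpha}$ ($c>0$, $\alpha\ge0$ constants independent of the matrix and of $k$): the set of symmetric doubly stochastic (irreducible, so that $\lambda$ is defined) matrices $A$ with $\lambda(A)\ge \Delta_k:=c\log^{-\alpha}k$, where $k$ is the dimension of $A$. Reconnected cycle model $H_n(A)$: let $n\ge k$ be integers and $A\in\mathbb{R}^{k\times k}$ symmetric doubly stochastic. (1) Start with a directed cycle on $n$ vertices where every edge has weight $1$. (2) Select uniformly at random $k$ distinct edges of the cycle; pick one of them uniformly at random and denote it $(e_1,b_2)$, and label the subsequent ones, following the order of the cycle, by $(e_i,b_{i+1})$, $i=1,\dots,k$, with $k+1\equiv1$; remove these edges. (3) For each $i,j\in\{1,\dots,k\}$ add a directed edge from $e_j$ to $b_{i+1}$ with weight $A_{ij}=A_{ji}$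 (no edge if $A_{ij}=0$). $H_n(A)$ is the random Markov transition matrix ($n\times n$) of the resulting weighted directed graph; it is doubly stochastic. *)

(* Defs.v *)
From HB Require Import structures.
From mathcomp Require Import all_boot all_order all_algebra.
From mathcomp Require Import complex.
From mathcomp Require Import all_classical all_reals all_analysis.

Set Implicit Arguments.
Unset Strict Implicit.
Unset Printing Implicit Defensive.

Import Order.TTheory GRing.Theory Num.Theory.
Import numFieldNormedType.Exports.
Local Open Scope classical_set_scope.
Local Open Scope ring_scope.

Definition doubly_stochastic (R : realType) (d : nat) (A : 'M[R]_d) : Prop :=
  [/\ forall i j, 0 <= A i j,
      forall i, \sum_j A i j = 1 &
      forall j, \sum_i A i j = 1].

Definition irreducible_mx (R : realType) (d : nat) (A : 'M[R]_d) : Prop :=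
  forall i j : 'I_d, connect [rel x y | 0 < A x y] i j.

(* min {1 - |mu| : mu <> 1 a complex eigenvalue of A}: the set is finite, so
   its infimum is a minimum as soon as it is nonempty, which is the case for an
   irreducible doubly stochastic matrix of dimension at least 2 (1 is then a
   simple root of the characteristic polynomial). *)
Definition spectral_gap (R : realType) (d : nat) (A : 'M[R]_d) : R :=
  inf [set x : R | exists mu : complex R,
         [/\ mu != 1,
             eigenvalue (map_mx (real_complex R) A) mu &
             x = 1 - ComplexField.Normc.normc mu]].

Definition gap_class (R : realType) (c alpha : R) (d : nat) (A : 'M[R]_d)
  : Prop :=
  [/\ A^T = A, doubly_stochastic A, irreducible_mx A &
      c * ln d%:R `^ (- alpha) <= spectral_gap A].

(* The cycle has vertex set 'I_n and edges (v, ordS v), where ordS is the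
   successor modulo n; an edge is identified with its tail v.  An outcome is
   the set of the k selected edges together with the one of them that is
   labelled first.  The uniform law on these pairs is the law of the two-step
   choice (uniform k-subset, then uniform element of it), because all the
   k-subsets have the same number k of elements. *)
Definition outcomes (n k : nat) : {set {set 'I_n} * 'I_n} :=
  [set w : {set 'I_n} * 'I_n | (#|w.1| == k) && (w.2 \in w.1)]%SET.

Definition prob (R : realType) (n k : nat) (E : pred ({set 'I_n} * 'I_n)) : R :=
  #|[set w in outcomes n k | E w]%SET|%:R / #|outcomes n k|%:R.

(* Tails of the selected edges in cyclic order starting from the first one:
   with 0-based labels, the i-th selected edge is (e_ w i, b_next w i), so that
   e_ w i is e_(i+1) and b_next w i is b_(i+2) in 1-based labels. *)
Definition selected_tails (n : nat) (w : {set 'I_n} * 'I_n) : seq 'I_n :=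
  [seq v <- traject (@ordS n) w.2 n | v \in w.1].

Definition e_ (n : nat) (w : {set 'I_n} * 'I_n) (i : nat) : 'I_n :=
  nth w.2 (selected_tails w) i.

Definition b_next (n : nat) (w : {set 'I_n} * 'I_n) (i : nat) : 'I_n :=
  ordS (e_ w i).

(* Entry (u, v) is the total weight of the edges from u to v: the cycle edges
   that are not selected, and the edges from e_j to b_(i+1) of weight A i j. *)
Definition reconnected_cycle (R : realType) (n k : nat) (A : 'M[R]_k)
    (w : {set 'I_n} * 'I_n) : 'M[R]_n :=
  \matrix_(u, v)
    (((u \notin w.1) && (v == ordS u))%:R +
     \sum_(i < k) \sum_(j < k | (u == e_ w j) && (v == b_next w i)) A i j).

(* Main.v *)
Require Import Defs.
From HB Require Import structures.
From mathcomp Require Import all_boot all_order all_algebra.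
From mathcomp Require Import complex.
From mathcomp Require Import all_classical all_reals all_analysis.
From mathcomp Require Import ring lra zify.

Set Implicit Arguments.
Unset Strict Implicit.
Unset Printing Implicit Defensive.

Import Order.TTheory GRing.Theory Num.Theory.
Import numFieldNormedType.Exports.
Local Open Scope classical_set_scope.
Local Open Scope ring_scope.

(** Let v be a left eigenvector of the reconnected cycle for an eigenvalue
    mu <> 1, and let f_i be its value at the i-th selected tail. Along an
    unselected stretch of the cycle v is multiplied by 1 / mu at each step, so
    the eigenvalue equation collapses to k equations that see only the lengths
    l_i of the stretches (the gaps between consecutive selected edges):
      \sum_j A_ij f_j = mu ^ l_i * f_(i+1)          (lemma [eigen_gap]).
    Such an f is called a twisted eigenvector of A below, the twist being the
    diagonal of powers of mu and the cyclic shift of the indices.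

    Write L = ln k, delta = k / (n L ^ gamma), and suppose |mu| > 1 - delta.

    Rigidity. If no gap exceeds M = (n / k) L ^ 2, then all |mu ^ l_i| are
    within M delta of 1, so A hardly shrinks f. But A is symmetric with
    spectral gap Delta, hence contracts the vectors of sum zero
    ([gap_contraction]); therefore f is constant up to a relative squared error
    omega of order M delta / Delta ([twisted_eigenvector_near_constant]). The
    equations then force mu ^ l_i to be close to 1 for most i: with
    u = mu / |mu|, the mean of |u ^ l_i - 1| ^ 2 is at most 18 omega
    ([unit_phases_near1]).

    - If |u - 1| < 1 / (4 M), no phase has time to wind around the circle, so
      mu ^ l_i - 1 is about l_i (mu - 1). Summing the equations over i kills
      A, because its columns sum to 1, and leaves n (mu - 1) = 0 up to a
      smaller error: mu = 1 ([twisted_eigenvalue_near1_eq1]), a contradiction.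
    - If |u - 1| >= 1 / (4 M), the phases u ^ l_i of random gaps are spread
      over the circle, and it is very unlikely that the mean of
      |u ^ l_i - 1| ^ 2 is as small as 18 omega, even for one u that is allowed
      to depend on the outcome ([card_aligned_phases]).

    Probability. The gaps of a random outcome are independent geometric
    variables of mean n / k conditioned on having sum n. Since k is the mode of
    the binomial law with parameters n and k / n, this conditioning costs only
    a polynomial factor ([sum_prod_gaps]), which both rare events can afford: a
    gap above M has probability about exp (- L ^ 2), and for a fixed u the
    phases align with probability at most exp (- c k / L ^ 4), which survives a
    union bound over a net of polynomially many points of the circle.

    Powers of L. The mean of |u ^ l - 1| ^ 2 under the geometric law is of order
    1 / L ^ 4 when |u - 1| = 1 / (4 M), while omega is of order
    L ^ (2 + alpha - gamma), which gamma > 7 + alpha makes smaller than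
    1 / L ^ 5; the remaining factor L absorbs the constants. Finally
    n <= k ^ rho_u makes every polynomial in n a power of exp L. *)

Import ComplexField.Normc.

Local Notation toC := (real_complex _).

(** * Squared modulus and the contraction given by the spectral gap *)

(** Sums of squared moduli are handled as real numbers, so that real linear
    arithmetic applies to them. *)
Definition sqn (R : rcfType) (z : R[i]) : R := complex.Re z ^+ 2 + complex.Im z ^+ 2.

Section SquaredNorm.
Variable R : rcfType.
Implicit Types (z w : R[i]) (a : R).

Lemma sqn_ge0 z : 0 <= sqn z.
Proof. by rewrite addr_ge0 ?sqr_ge0. Qed.

Lemma sqnM z w : sqn (z * w) = sqn z * sqn w.
Proof. by case: z => a b; case: w => c d; rewrite /sqn /=; ring. Qed.

Lemma sqnN z : sqn (- z) = sqn z.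
Proof. by case: z => a b; rewrite /sqn /=; ring. Qed.

Lemma sqn0 : sqn (0 : R[i]) = 0.
Proof. by rewrite /sqn /= expr0n addr0. Qed.

Lemma sqn1 : sqn (1 : R[i]) = 1.
Proof. by rewrite /sqn /= expr0n expr1n addr0. Qed.

Lemma sqnX z n : sqn (z ^+ n) = sqn z ^+ n.
Proof. by elim: n => [|n IH]; rewrite ?expr0 ?sqn1 // !exprS sqnM IH. Qed.

Lemma sqn_eq0 z : (sqn z == 0) = (z == 0).
Proof.
case: z => a b; rewrite /sqn /= paddr_eq0 ?sqr_ge0 // !sqrf_eq0.
by rewrite eq_complex.
Qed.

Lemma sqn_toC a : sqn (toC a) = a ^+ 2.
Proof. by rewrite /sqn /= expr0n addr0. Qed.

Lemma sqnD_le z w : sqn (z + w) <= 2 * sqn z + 2 * sqn w.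
Proof.
case: z => a b; case: w => c d; rewrite /sqn /=.
have := sqr_ge0 (a - c); have := sqr_ge0 (b - d); nra.
Qed.

Lemma sqnB_le z w : sqn (z - w) <= 2 * sqn z + 2 * sqn w.
Proof. by rewrite -(sqnN w) sqnD_le. Qed.

Lemma sqn_normc z : sqn z = normc z ^+ 2.
Proof. by case: z => a b; rewrite /sqn /= sqr_sqrtr // addr_ge0 ?sqr_ge0. Qed.

Lemma normc_ge0 z : 0 <= normc z.
Proof. by case: z => a b /=; rewrite sqrtr_ge0. Qed.

Lemma toC_normc z : toC (normc z) = `|z|.
Proof. by case: z => a b; rewrite normc_def. Qed.

Lemma normcD_le z w : normc (z + w) <= normc z + normc w.
Proof. by rewrite -lecR rmorphD /= !toC_normc ler_normD. Qed.

Lemma normc_neg z : normc (- z) = normc z.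
Proof. by rewrite -[LHS]/(complex.Re (toC _)) toC_normc normrN -toC_normc. Qed.

Lemma normc_toC a : 0 <= a -> normc (toC a) = a.
Proof. by move=> a0; rewrite /= expr0n addr0 sqrtr_sqr ger0_norm. Qed.

Lemma normc_nat n : normc (n%:R : R[i]) = n%:R.
Proof. by rewrite -[n%:R](rmorph_nat (real_complex R)) normc_toC. Qed.

Lemma normcX z n : normc (z ^+ n) = normc z ^+ n.
Proof. by elim: n => [|n IH]; rewrite ?expr0 ?normc1 // !exprS normcM IH. Qed.

Lemma normc_sum (I : Type) (r : seq I) (P : pred I) (F : I -> R[i]) :
  normc (\sum_(i <- r | P i) F i) <= \sum_(i <- r | P i) normc (F i).
Proof.
elim/big_ind2: _ => [|x y z w h1 h2|//]; first by rewrite normc0.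
by rewrite (le_trans (normcD_le _ _)) // lerD.
Qed.

Lemma normc_eq0 z : (normc z == 0) = (z == 0).
Proof. by apply/eqP/eqP => [/eq0_normc //|->]; rewrite normc0. Qed.

Lemma sqn_conj z : z * z^*%C = toC (sqn z).
Proof. by case: z => a b; apply/eqP; rewrite eq_complex /sqn /=; apply/andP; split; apply/eqP; ring. Qed.

End SquaredNorm.

Section Contraction.
Variables (R : realType) (k : nat).
Implicit Types (A : 'M[R]_k).
Local Notation cmx := (map_mx (real_complex R)).

(** Multiplication by a stochastic matrix does not increase the l^1 norm of a
    row vector. *)
Lemma stochastic_eigenvalue_le1 A mu : doubly_stochastic A ->
  eigenvalue (cmx A) mu -> normc mu <= 1.
Proof.
move=> [A0 Ar Ac] /eigenvalueP[v vA v0].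
have S0 : 0 < \sum_j normc (v 0 j).
  have /rV0Pn[j vj] := v0.
  rewrite (bigD1 j) //= ltr_wpDr ?sumr_ge0 // => [i _|]; first exact: normc_ge0.
  by rewrite lt_def normc_eq0 vj normc_ge0.
rewrite -(ler_pM2r S0) mul1r mulr_sumr.
have E j : normc mu * normc (v 0 j) <= \sum_i normc (v 0 i) * A i j.
  rewrite -normcM; move/rowP: vA => /(_ j); rewrite !mxE => <-.
  rewrite (le_trans (normc_sum _ _ _)) // ler_sum // => i _.
  by rewrite mxE normcM normc_toC.
apply: (le_trans (ler_sum _ (fun j _ => E j))).
rewrite exchange_big /= ler_sum // => i _.
by rewrite -mulr_sumr Ar mulr1.
Qed.

(** An infimum is below each member of a set only if the set is bounded below;
    here 0 is a lower bound because eigenvalues have modulus at most 1. *)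
Lemma gap_le_eigenvalue A mu : doubly_stochastic A ->
  eigenvalue (cmx A) mu -> mu != 1 -> spectral_gap A <= 1 - normc mu.
Proof.
move=> dsA ev mu1; apply: ge_inf; last by exists mu.
exists 0 => _ [nu [_ evnu ->]].
by rewrite subr_ge0 (stochastic_eigenvalue_le1 dsA).
Qed.

(** The Dirichlet form \sum_(i, j) A_ij (x_i - x_j) ^ 2 of a harmonic vector
    vanishes, so x takes the same value at the two ends of every edge. *)
Lemma harmonic_constant A (x : 'I_k -> R) : A^T = A -> doubly_stochastic A ->
  irreducible_mx A -> (forall j, \sum_i x i * A i j = x j) ->
  forall i j, x i = x j.
Proof.
move=> sA [A0 Ar Ac] irr xA.
have E0 : \sum_i \sum_j A i j * (x i - x j) ^+ 2 = 0.
  have -> : \sum_i \sum_j A i j * (x i - x j) ^+ 2 =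
     \sum_i \sum_j A i j * x i ^+ 2 + \sum_i \sum_j A i j * x j ^+ 2
     - 2 * \sum_j (\sum_i x i * A i j) * x j.
    rewrite [X in _ - 2 * X](eq_bigr (fun j => \sum_i x i * A i j * x j)); last first.
      by move=> j _; rewrite mulr_suml.
    rewrite [X in _ - 2 * X]exchange_big /= mulr_sumr -sumrN -!big_split /=.
    apply: eq_bigr => i _; rewrite mulr_sumr -sumrN -!big_split /=.
    by apply: eq_bigr => j _; ring.
  have -> : \sum_i \sum_j A i j * x i ^+ 2 = \sum_i x i ^+ 2.
    by apply: eq_bigr => i _; rewrite -mulr_suml Ar mul1r.
  rewrite exchange_big /=.
  have -> : \sum_j \sum_i A i j * x j ^+ 2 = \sum_i x i ^+ 2.
    by apply: eq_bigr => i _; rewrite -mulr_suml Ac mul1r.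
  rewrite [X in _ - 2 * X](eq_bigr (fun j => x j ^+ 2)); first by ring.
  by move=> j _; rewrite xA expr2.
have T0 i j : 0 <= A i j * (x i - x j) ^+ 2 by rewrite mulr_ge0 ?sqr_ge0.
(* All the terms of the Dirichlet form are nonnegative. *)
have step i j : 0 < A i j -> x i = x j.
  move=> Aij.
  have Ei := psumr_eq0P (fun i _ => sumr_ge0 _ (fun j _ => T0 i j)) E0.
  have /eqP := psumr_eq0P (fun j _ => T0 i j) (Ei i isT) (i := j) isT.
  by rewrite mulf_eq0 gt_eqF //= sqrf_eq0 subr_eq0 => /eqP.
move=> i j; have /connectP[p] := irr i j.
elim: p i => [i _ -> //|y p IH i /= /andP[iy yp] jl].
by rewrite (step _ _ iy); apply: IH.
Qed.

Definition norm2 (m : nat) (v : 'rV[R[i]]_m) : R := \sum_i sqn (v 0 i).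

Local Open Scope sesquilinear_scope.

Lemma norm2E (m : nat) (v : 'rV[R[i]]_m) : toC (norm2 v) = (v *m v^t*) 0 0.
Proof.
rewrite mxE rmorph_sum; apply: eq_bigr => i _.
by rewrite !mxE; exact: esym (sqn_conj _).
Qed.

Lemma norm2_unitary (m : nat) (v : 'rV[R[i]]_m) (P : 'M[R[i]]_m) :
  P \is unitarymx -> norm2 (v *m P) = norm2 v.
Proof.
move=> Pu; apply: (@complexI R); rewrite !norm2E.
rewrite trmx_mul map_mxM !mulmxA; congr (_ 0 0).
by rewrite mulmxtVK.
Qed.

(** In a unitary eigenbasis of A, the eigenvectors for the eigenvalue 1 are
    constant by irreducibility, hence orthogonal to h; the other eigenvalues d
    satisfy |d| ^ 2 <= |d| <= 1 - Delta. The factor is 1 - Delta and not its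
    square because only the first order in Delta matters later. *)
Lemma gap_contraction A (Delta : R) (h : 'I_k -> R[i]) : A^T = A ->
  doubly_stochastic A -> irreducible_mx A -> Delta <= spectral_gap A ->
  \sum_i h i = 0 ->
  \sum_i sqn (\sum_j toC (A i j) * h j) <= (1 - Delta) * \sum_i sqn (h i).
Proof.
move=> sA dsA irr gapA h0.
set Ac := cmx A; set P := spectralmx Ac; set d := spectral_diag Ac.
have Pu : P \is unitarymx by apply: spectral_unitarymx.
have AcE : Ac = P^t* *m diag_mx d *m P.
  rewrite -invmx_unitary //; apply/orthomx_spectralP.
  apply/normalmxP; suff -> : Ac^t* = Ac by [].
  apply/matrixP => i j; rewrite !mxE -[in RHS]sA mxE.
  by apply/eqP; rewrite eq_complex /= oppr0 !eqxx.
pose v : 'rV[R[i]]_k := \row_i h i.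
have -> : \sum_i sqn (h i) = norm2 (v *m P^t*).
  rewrite norm2_unitary ?trmxC_unitary //.
  by apply: eq_bigr => i _; rewrite mxE.
have -> : \sum_i sqn (\sum_j toC (A i j) * h j) = norm2 (v *m P^t* *m diag_mx d).
  rewrite -(norm2_unitary (v *m P^t* *m diag_mx d) Pu).
  have -> : v *m P^t* *m diag_mx d *m P = v *m Ac by rewrite AcE !mulmxA.
  apply: eq_bigr => i _; rewrite mxE; congr sqn.
  by apply: eq_bigr => j _; rewrite !mxE mulrC -[in LHS]sA mxE.
rewrite /norm2 mulr_sumr; apply: ler_sum => i _.
rewrite mul_mx_diag mxE sqnM mulrC.
have rowA : row i P *m Ac = d 0 i *: row i P.
  rewrite AcE !mulmxA -row_mul; have /unitarymxP -> := Pu.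
  rewrite -mulmxA row1 -rowE; apply/rowP => j.
  by rewrite !mxE (bigD1 i) //= !mxE eqxx mulr1n big1 ?addr0 // => l li;
     rewrite !mxE eq_sym (negPf li) mulr0n mul0r.
have row0 : row i P != 0.
  apply/negP => /eqP r0; have /row_unitarymxP/(_ i i) := Pu.
  by rewrite r0 dotmxE mul0mx mxE eqxx => /esym/eqP; rewrite oner_eq0.
have ev : eigenvalue Ac (d 0 i) by apply/eigenvalueP; exists (row i P).
(* Eigenvalues other than 1 are bounded by the gap; for the eigenvalue 1 the
   coordinate of h vanishes. *)
have [d1|d1] := eqVneq (d 0 i) 1; last first.
  apply: ler_wpM2r; first exact: sqn_ge0.
  have := gap_le_eigenvalue dsA ev d1.
  have := stochastic_eigenvalue_le1 dsA ev; have := normc_ge0 (d 0 i).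
  rewrite sqn_normc; nra.
suff -> : (v *m P^t*) 0 i = 0 by rewrite sqn0 !mulr0.
have cst f : (forall j, \sum_l f (P i l) * A l j = f (P i j)) ->
    forall j l, f (P i j) = f (P i l).
  by move=> fA; apply: (harmonic_constant (x := fun j => f (P i j)) sA dsA irr).
have PA j : \sum_l P i l * toC (A l j) = P i j.
  move/rowP: rowA => /(_ j); rewrite d1 scale1r !mxE => <-.
  by apply: eq_bigr => l _; rewrite !mxE.
have Pre : forall j l, complex.Re (P i j) = complex.Re (P i l).
  apply: cst => j; rewrite -[in RHS]PA raddf_sum /=; apply: eq_bigr => l _.
  by case: (P i l) => a b /=; rewrite mulr0 subr0.
have Pim : forall j l, complex.Im (P i j) = complex.Im (P i l).
  apply: cst => j; rewrite -[in RHS]PA raddf_sum /=; apply: eq_bigr => l _.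
  by case: (P i l) => a b /=; rewrite mulr0 add0r.
rewrite mxE (eq_bigr (fun j => h j * (P i i)^*%C)) -?mulr_suml ?h0 ?mul0r //.
move=> j _; rewrite !mxE; congr (_ * _^*%C).
by apply/eqP; rewrite eq_complex (Pre j i) (Pim j i) !eqxx.
Qed.

End Contraction.

(** * Rigidity of twisted eigenvectors *)

Section Rigidity.
Variables (R : realType) (k : nat) (A : 'M[R]_k) (Delta eps omega : R).
Variables (ell : 'I_k -> nat) (sg : 'I_k -> 'I_k) (mu : R[i]).
Hypothesis k_gt0 : (0 < k)%N.
Hypothesis dsA : doubly_stochastic A.
Hypothesis contrA : forall h : 'I_k -> R[i], \sum_i h i = 0 ->
  \sum_i sqn (\sum_j toC (A i j) * h j) <= (1 - Delta) * \sum_i sqn (h i).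
Hypothesis sg_inj : injective sg.
Hypothesis ell_gt0 : forall i, (0 < ell i)%N.
Hypothesis Delta_gt0 : 0 < Delta.
Hypothesis Delta_le1 : Delta <= 1.

Let rowA i : \sum_j A i j = 1. Proof. by case: dsA => _ ->. Qed.
Let colA j : \sum_i A i j = 1. Proof. by case: dsA => _ _ ->. Qed.
Let k_neq0 : (k%:R : R[i]) != 0. Proof. by rewrite pnatr_eq0 -lt0n. Qed.

Let sum_sg (V : nmodType) (F : 'I_k -> V) : \sum_i F (sg i) = \sum_i F i.
Proof. by rewrite [RHS](reindex_inj sg_inj). Qed.

Lemma sum_sqn_shift (a : R[i]) (h : 'I_k -> R[i]) : \sum_i h i = 0 ->
  \sum_i sqn (a + h i) = k%:R * sqn a + \sum_i sqn (h i).
Proof.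
move=> h0.
have E i : sqn (a + h i) = sqn a + sqn (h i)
    + 2 * (complex.Re a * complex.Re (h i) + complex.Im a * complex.Im (h i)).
  by case: a (h i) => a1 a2 [b1 b2]; rewrite /sqn /=; ring.
rewrite (eq_bigr _ (fun i _ => E i)) 2!big_split /= sumr_const card_ord -[sqn a *+ k]mulr_natl.
rewrite -[RHS]addr0; congr (_ + _).
rewrite -mulr_sumr big_split /= -!mulr_sumr -!raddf_sum /= h0 /=.
by rewrite !mulr0 addr0 mulr0.
Qed.

Lemma sum_mulA (h : 'I_k -> R[i]) : \sum_i \sum_j toC (A i j) * h j = \sum_j h j.
Proof.
rewrite exchange_big /=; apply: eq_bigr => j _.
by rewrite -mulr_suml -rmorph_sum colA mul1r.
Qed.

Lemma mulA_shift (a : R[i]) (h : 'I_k -> R[i]) i :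
  \sum_j toC (A i j) * (a + h j) = a + \sum_j toC (A i j) * h j.
Proof.
under eq_bigr do rewrite mulrDr.
by rewrite big_split /= -mulr_suml -rmorph_sum rowA mul1r.
Qed.

Section Eigenvector.
Variable f : 'I_k -> R[i].
Hypothesis relf : forall i, \sum_j toC (A i j) * f j = mu ^+ ell i * f (sg i).
Hypothesis f_neq0 : exists i, f i != 0.

Let a := (\sum_i f i) / k%:R.
Let h i := f i - a.
Let hE i : f i = a + h i. Proof. by rewrite /h addrC subrK. Qed.
Let h0 : \sum_i h i = 0.
Proof.
rewrite big_split /= sumr_const card_ord -mulr_natl mulrN /a mulrC divfK //.
by rewrite subrr.
Qed.
Let H := \sum_i sqn (h i).
Let H0 : 0 <= H. Proof. by apply: sumr_ge0 => i _; apply: sqn_ge0. Qed.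

Let normf : \sum_i sqn (f i) = k%:R * sqn a + H.
Proof. by rewrite -(sum_sqn_shift a h0); apply: eq_bigr => i _; rewrite -hE. Qed.

Let normf_gt0 : 0 < \sum_i sqn (f i).
Proof.
have [i fi] := f_neq0; rewrite (bigD1 i) //= ltr_wpDr ?sumr_ge0 //.
  by move=> j _; apply: sqn_ge0.
by rewrite lt_def sqn_eq0 fi sqn_ge0.
Qed.

Let normAf : \sum_i sqn (mu ^+ ell i * f (sg i)) <= k%:R * sqn a + (1 - Delta) * H.
Proof.
have -> : \sum_i sqn (mu ^+ ell i * f (sg i)) =
    \sum_i sqn (a + \sum_j toC (A i j) * h j).
  apply: eq_bigr => i _; rewrite -relf -mulA_shift; congr sqn.
  by apply: eq_bigr => j _; rewrite -hE.
rewrite sum_sqn_shift ?sum_mulA // lerD2l.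
exact: contrA.
Qed.

(** A does not increase the l^2 norm, whereas |mu| > 1 would make the right-hand
    side of the equations strictly longer than f. *)
Lemma twisted_eigenvalue_le1 : normc mu <= 1.
Proof.
rewrite leNgt; apply/negP => mu1.
have s1 : 1 < sqn mu by rewrite sqn_normc exprn_egt1.
have: sqn mu * \sum_i sqn (f i) <= \sum_i sqn (f i).
  rewrite -[X in _ * X]sum_sg mulr_sumr normf.
  apply: le_trans (le_trans normAf _); last first.
    by rewrite lerD2l ler_piMl //; have := Delta_gt0; lra.
  apply: ler_sum => i _; rewrite sqnM ler_wpM2r ?sqn_ge0 // sqnX.
  by apply: ler_eXnr => //; apply: ltW.
by rewrite ger_pMl ?normf_gt0 // leNgt s1.
Qed.

Hypothesis eps_ge0 : 0 <= eps.
Hypothesis eps_le1 : eps <= 1.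
Hypothesis ell_eps : forall i, 1 - eps <= normc (mu ^+ ell i).
Hypothesis eps_omega : 2 * eps <= omega * Delta.
Hypothesis omega_le : omega <= 2^-1.

(** Split f into its mean a and a part h of sum zero. The equations give
      (1 - eps) ^ 2 (k |a| ^ 2 + |h| ^ 2) <= k |a| ^ 2 + (1 - Delta) |h| ^ 2,
    so Delta |h| ^ 2 is at most 2 eps |f| ^ 2. In particular a <> 0, and
    g = h / a solves the equations normalised to mean 1. *)
Lemma twisted_eigenvector_near_constant : exists g : 'I_k -> R[i],
  [/\ \sum_i g i = 0, \sum_i sqn (g i) <= 2 * omega * k%:R &
      forall i, 1 + \sum_j toC (A i j) * g j = mu ^+ ell i * (1 + g (sg i))].
Proof.
have lowN : (1 - 2 * eps) * \sum_i sqn (f i) <= \sum_i sqn (mu ^+ ell i * f (sg i)).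
  rewrite -[X in _ * X]sum_sg mulr_sumr; apply: ler_sum => i _.
  rewrite sqnM ler_wpM2r ?sqn_ge0 // sqn_normc.
  have := ell_eps i; have := eps_le1; have := eps_ge0; nra.
have HN : H <= omega * (k%:R * sqn a + H).
  have := le_trans lowN normAf; rewrite normf => h1.
  rewrite -(ler_pM2l Delta_gt0) mulrA [Delta * omega]mulrC.
  have N0 : 0 <= k%:R * sqn a + H by rewrite addr_ge0 ?mulr_ge0 ?sqn_ge0.
  have := ler_wpM2r N0 eps_omega; nra.
have HK : H <= 2 * omega * (k%:R * sqn a).
  have K0 : 0 <= k%:R * sqn a by rewrite mulr_ge0 ?sqn_ge0.
  have := ler_wpM2r H0 omega_le; nra.
have a0 : a != 0.
  apply/negP => /eqP a0; have := normf_gt0; rewrite normf.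
  by move: HK; rewrite a0 sqn0 !mulr0 add0r => /le_lt_trans H1 /H1; rewrite ltxx.
have sa0 : 0 < sqn a by rewrite lt_def sqn_eq0 a0 sqn_ge0.
exists (fun i => h i / a); split.
- by rewrite -mulr_suml h0 mul0r.
- rewrite -(ler_pM2r sa0) mulr_suml -[X in _ <= X]mulrA.
  rewrite (eq_bigr (fun i => sqn (h i))) // => i _.
  by rewrite -sqnM divfK.
- move=> i; apply: (mulIf a0).
  rewrite mulrDl mul1r mulr_suml.
  have -> : \sum_j toC (A i j) * (h j / a) * a = \sum_j toC (A i j) * h j.
    by apply: eq_bigr => j _; rewrite -mulrA divfK.
  rewrite -mulA_shift -mulrA mulrDl mul1r divfK // -hE -relf.
  by apply: eq_bigr => j _; rewrite -hE.
Qed.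

End Eigenvector.

Section NearConstant.
Variables (g : 'I_k -> R[i]).
Hypothesis g0 : \sum_i g i = 0.
Hypothesis gsmall : \sum_i sqn (g i) <= 2 * omega * k%:R.
Hypothesis relg : forall i, 1 + \sum_j toC (A i j) * g j = mu ^+ ell i * (1 + g (sg i)).
Hypothesis mu_le1 : normc mu <= 1.

Let normX_le1 t : normc (mu ^+ t) <= 1.
Proof. by rewrite normcX exprn_ile1 // normc_ge0. Qed.

(** The equations read mu ^ ell_i - 1 = (A g)_i - mu ^ ell_i g_(sg i), a
    difference of two small vectors. *)
Lemma phases_near1 : \sum_i sqn (mu ^+ ell i - 1) <= 8 * omega * k%:R.
Proof.
have E i : sqn (mu ^+ ell i - 1) <=
    2 * sqn (\sum_j toC (A i j) * g j) + 2 * sqn (g (sg i)).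
  have -> : mu ^+ ell i - 1 = \sum_j toC (A i j) * g j - mu ^+ ell i * g (sg i).
    by have := relg i; rewrite mulrDr mulr1 => /(canRL (addKr _)) ->; ring.
  apply: le_trans (sqnB_le _ _) _; rewrite lerD2l ler_pM2l // sqnM.
  rewrite -[leRHS]mul1r ler_wpM2r ?sqn_ge0 // sqn_normc.
  by rewrite exprn_ile1 ?normc_ge0.
apply: (le_trans (ler_sum _ (fun i _ => E i))).
rewrite big_split /= -!mulr_sumr (sum_sg (fun i => sqn (g i))).
have S0 : 0 <= \sum_i sqn (g i) by apply: sumr_ge0 => i _; apply: sqn_ge0.
have := mulr_ge0 (ltW Delta_gt0) S0; have := contrA g0; have := gsmall; lra.
Qed.

(** Replacing mu by the point u of the unit circle costs 1 - |mu| ^ ell_i in each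
    phase, which is at most eps and so is absorbed by omega. *)
Lemma unit_phases_near1 (u : R[i]) : mu = toC (normc mu) * u -> sqn u = 1 ->
  0 <= eps -> eps <= 1 -> (forall i, 1 - eps <= normc (mu ^+ ell i)) ->
  2 * eps <= omega * Delta ->
  \sum_i sqn (u ^+ ell i - 1) <= 18 * omega * k%:R.
Proof.
move=> muE u1 e0 e1 ell_eps eo.
have E i : sqn (u ^+ ell i - 1) <= omega + 2 * sqn (mu ^+ ell i - 1).
  have -> : u ^+ ell i - 1 =
      toC (1 - normc mu ^+ ell i) * u ^+ ell i + (mu ^+ ell i - 1).
    by rewrite {2}muE exprMn rmorphB rmorph1 rmorphXn /=; ring.
  apply: le_trans (sqnD_le _ _) _; rewrite lerD2r sqnM sqn_toC sqnX u1 expr1n mulr1.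
  have := ell_eps i; have := normX_le1 (ell i); rewrite normcX => h1 h2.
  have o0 : 0 <= omega by have := Delta_gt0; nra.
  have := ler_wpM2l o0 Delta_le1; rewrite mulr1; nra.
apply: (le_trans (ler_sum _ (fun i _ => E i))).
rewrite big_split /= sumr_const card_ord -mulr_sumr -mulr_natl.
have := phases_near1; have : 0 <= omega * k%:R by rewrite mulr_ge0 //; have := Delta_gt0; nra.
nra.
Qed.

(** Summed over i, the equations lose A since its columns sum to 1:
    \sum_i (mu ^ ell_i - 1) (1 + g_(sg i)) = 0. If mu <> 1, dividing by mu - 1
    replaces mu ^ ell_i - 1 by the geometric sum S_i of the powers mu ^ t for
    t < ell_i, which is close to ell_i because mu does not wind. Then
    \sum_i S_i has modulus at least n / 2, while \sum_i S_i g_(sg i) is too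
    small to cancel it. *)
Lemma twisted_eigenvalue_near1_eq1 (n : nat) (M kappa : R) : normc (mu - 1) <= kappa ->
  (forall i, (ell i)%:R <= M) -> M * kappa <= 2^-1 ->
  (\sum_i ell i = n)%N -> 8 * M * omega * k%:R < n%:R -> mu = 1.
Proof.
move=> mukap ellM Mkap suml small; apply/eqP; rewrite -subr_eq0.
apply/negPn/negP => mu1.
pose S i : R[i] := \sum_(t < ell i) mu ^+ t.
have SE i : mu ^+ ell i - 1 = (mu - 1) * S i by rewrite subrX1.
have sumS : \sum_i S i = - \sum_i S i * g (sg i).
  apply: (mulfI mu1); rewrite mulrN !mulr_sumr.
  apply/eqP; rewrite -addr_eq0 -big_split /=; apply/eqP.
  transitivity (\sum_i (mu ^+ ell i * (1 + g (sg i)) - (1 + g (sg i)))).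
    by apply: eq_bigr => i _; rewrite mulrA -SE; ring.
  rewrite sumrB; under eq_bigr do rewrite -relg.
  rewrite !big_split /= sum_mulA g0 (sum_sg g) g0 !addr0.
  by rewrite subrr.
have powB t : normc (mu ^+ t - 1) <= t%:R * kappa.
  rewrite subrX1 normcM mulrC ler_pM ?normc_ge0 //.
  apply: le_trans (normc_sum _ _ _) _.
  apply: le_trans (ler_sum _ (fun i _ => normX_le1 _)) _.
  by rewrite sumr_const card_ord.
have kap0 : 0 <= kappa by apply: le_trans mukap; apply: normc_ge0.
have SB i : normc (S i - (ell i)%:R) <= (ell i)%:R * 2^-1.
  have -> : S i - (ell i)%:R = \sum_(t < ell i) (mu ^+ t - 1).
    by rewrite sumrB sumr_const card_ord.
  apply: le_trans (normc_sum _ _ _) _.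
  apply: (@le_trans _ _ (\sum_(t < ell i) (2^-1 : R))).
    apply: ler_sum => t _; apply: le_trans (powB t) _.
    apply: le_trans Mkap; apply: ler_wpM2r => //; apply: le_trans (ellM i).
    by rewrite ler_nat ltnW.
  by rewrite sumr_const card_ord mulr_natl.
have Sle i : normc (S i) <= (ell i)%:R.
  apply: le_trans (normc_sum _ _ _) _.
  apply: le_trans (ler_sum _ (fun i _ => normX_le1 _)) _.
  by rewrite sumr_const card_ord.
have n_gt0 : (0 < n)%N by rewrite -suml (bigD1 (Ordinal k_gt0)) //= addn_gt0 ell_gt0.
have M0 : 0 < M by apply: lt_le_trans (ellM (Ordinal k_gt0)); rewrite ltr0n ell_gt0.
have sumnR : \sum_i (ell i)%:R = n%:R :> R by rewrite -suml natr_sum.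
have low : n%:R * 2^-1 <= normc (\sum_i S i).
  have : normc (\sum_i (S i - (ell i)%:R)) <= n%:R * 2^-1.
    apply: le_trans (normc_sum _ _ _) _.
    apply: le_trans (ler_sum _ (fun i _ => SB i)) _.
    by rewrite -mulr_suml sumnR.
  have : normc (n%:R : R[i]) <= normc (\sum_i S i) + normc (- \sum_i (S i - (ell i)%:R)).
    apply: le_trans (normcD_le _ _); rewrite le_eqVlt; apply/orP; left; apply/eqP; congr normc.
    by rewrite sumrB -suml natr_sum; ring.
  rewrite normc_nat normc_neg; lra.
have up : normc (\sum_i S i) <= n%:R * 4^-1 + 2 * M * omega * k%:R.
  rewrite sumS normc_neg; apply: le_trans (normc_sum _ _ _) _.
  (* From t <= 1 / 4 + t ^ 2 and ell_i <= M; the first terms add up to n / 4, half of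
     the lower bound on the modulus of the sum of the S_i. *)
  have E i : normc (S i * g (sg i)) <= (ell i)%:R * 4^-1 + M * sqn (g (sg i)).
    rewrite normcM.
    apply: (@le_trans _ _ ((ell i)%:R * normc (g (sg i)))).
      by rewrite ler_wpM2r ?normc_ge0 ?Sle.
    have q0 : 0 <= sqn (g (sg i)) by apply: sqn_ge0.
    apply: (@le_trans _ _ ((ell i)%:R * 4^-1 + (ell i)%:R * sqn (g (sg i)))).
      rewrite -mulrDr ler_wpM2l // sqn_normc.
      have := sqr_ge0 (normc (g (sg i)) - 2^-1); lra.
    by rewrite lerD2l ler_wpM2r.
  apply: le_trans (ler_sum _ (fun i _ => E i)) _.
  rewrite big_split /= -mulr_suml -mulr_sumr sumnR (sum_sg (fun i => sqn (g i))).
  rewrite lerD2l; have := ler_wpM2l (ltW M0) gsmall; lra.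
lra.
Qed.

End NearConstant.
End Rigidity.

(** * The gaps of an outcome and the eigenvalue equation *)

(** Positions of the selected tails, counted along the cycle from the one that
    is labelled first. *)
Definition times (n : nat) (w : {set 'I_n} * 'I_n) : seq nat :=
  [seq t <- iota 0 n | iter t (@ordS n) w.2 \in w.1].

(** Past the last selected tail the default value n of [nth] is the position at
    which the cycle returns to its start, so the last gap wraps around. *)
Definition gap (n : nat) (w : {set 'I_n} * 'I_n) (i : nat) : nat :=
  nth n (times w) i.+1 - nth n (times w) i.

Lemma val_iter_ordS (n : nat) (v : 'I_n) t : iter t (@ordS n) v = ((v + t) %% n)%N :> nat.
Proof.
elim: t => [|t IH]; first by rewrite addn0 modn_small.
by rewrite iterS /= IH -[in LHS]addn1 modnDml addn1 addnS.
Qed.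

Lemma iter_ordS_n (n : nat) (v : 'I_n) : iter n (@ordS n) v = v.
Proof. by apply: val_inj; rewrite /= val_iter_ordS modnDr modn_small. Qed.

Lemma iter_ordS_inj (n : nat) (v : 'I_n) s t : (s < n)%N -> (t < n)%N ->
  iter s (@ordS n) v = iter t (@ordS n) v -> s = t.
Proof.
move=> sn tn /(congr1 val); rewrite /= !val_iter_ordS => /eqP.
by rewrite eqn_modDl !modn_small // => /eqP.
Qed.

Lemma iter_ordS_surj (n : nat) (v x : 'I_n) :
  exists2 t, (t < n)%N & iter t (@ordS n) v = x.
Proof.
exists ((x + (n - v)) %% n)%N; first by rewrite ltn_mod (leq_ltn_trans _ (ltn_ord v)).
apply: val_inj; rewrite /= val_iter_ordS modnDmr addnCA subnKC ?modnDr ?modn_small //.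
exact: ltnW.
Qed.

Section Times.
Variables (n k : nat) (w : {set 'I_n} * 'I_n).
Hypothesis wP : w \in outcomes n k.

Local Notation go t := (iter t (@ordS n) w.2).
Local Notation T := (times w).

Let cardw : #|w.1| = k. Proof. by move: wP; rewrite inE => /andP[/eqP]. Qed.
Let w21 : w.2 \in w.1. Proof. by move: wP; rewrite inE => /andP[]. Qed.
Let n_gt0 : (0 < n)%N. Proof. exact: leq_ltn_trans (ltn_ord w.2). Qed.

Lemma outcome_gt0 : (0 < k)%N.
Proof. by rewrite -cardw card_gt0; apply/set0Pn; exists w.2. Qed.

Lemma mem_times t : (t \in T) = (t < n)%N && (go t \in w.1).
Proof. by rewrite mem_filter mem_iota leq0n add0n andbC. Qed.

Lemma set_of_times : w.1 = [set x | x \in [seq go t | t <- T]]%SET.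
Proof.
apply/setP => x; rewrite inE; apply/idP/mapP => [xw|[t]].
  have [t tn tx] := iter_ordS_surj w.2 x.
  by exists t => //; rewrite mem_times tn tx.
by rewrite mem_times => /andP[_ tw] ->.
Qed.

Lemma size_times : size T = k.
Proof.
rewrite -cardw set_of_times cardsE.
rewrite -(size_map (fun t => go t)); apply/esym/card_uniqP.
rewrite map_inj_in_uniq ?filter_uniq ?iota_uniq // => s t.
rewrite !mem_times => /andP[sn _] /andP[tn _]; exact: iter_ordS_inj.
Qed.

Lemma sorted_times : sorted ltn T.
Proof. by apply: sorted_filter; [exact: ltn_trans|exact: iota_ltn_sorted]. Qed.

Lemma nth_times_lt i : (i < k)%N -> (nth n T i < n)%N.
Proof.
move=> ik; have : nth n T i \in T by rewrite mem_nth ?size_times.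
by rewrite mem_times => /andP[].
Qed.

Lemma nth_times_mem i : (i < k)%N -> go (nth n T i) \in w.1.
Proof.
move=> ik; have : nth n T i \in T by rewrite mem_nth ?size_times.
by rewrite mem_times => /andP[].
Qed.

Lemma nth_times_k : nth n T k = n.
Proof. by rewrite nth_default ?size_times. Qed.

Lemma nth_times_mono i j : (i < j)%N -> (j <= k)%N -> (nth n T i < nth n T j)%N.
Proof.
move=> ij; rewrite leq_eqVlt => /orP[/eqP jk|jk].
  by rewrite jk nth_times_k nth_times_lt // -jk.
apply: (sorted_ltn_nth ltn_trans n sorted_times) => //.
  by rewrite inE size_times (ltn_trans ij).
by rewrite inE size_times.
Qed.

Lemma nth_times0 : nth n T 0 = 0%N.
Proof.
have : 0%N \in T by rewrite mem_times n_gt0 /= w21.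
case/(nthP n) => -[//|i]; rewrite size_times => ik ti.
by have := nth_times_mono (ltn0Sn i) (ltnW ik); rewrite ti.
Qed.

Lemma gap_gt0 i : (i < k)%N -> (0 < gap w i)%N.
Proof. by move=> ik; rewrite subn_gt0 nth_times_mono. Qed.

Lemma gapE i : (i < k)%N -> (nth n T i + gap w i)%N = nth n T i.+1.
Proof. by move=> ik; rewrite subnKC // ltnW // nth_times_mono. Qed.

Lemma gap_le_n i : (gap w i <= n)%N.
Proof.
rewrite /gap; apply: leq_trans (leq_subr _ _) _.
have [ik|ik] := ltnP i.+1 k; first by rewrite ltnW // nth_times_lt.
by rewrite nth_default ?size_times.
Qed.

Lemma sum_gap : (\sum_(i < k) gap w i = n)%N.
Proof.
suff H m : (m <= k)%N -> (\sum_(i < m) gap w i = nth n T m)%N.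
  by rewrite H // nth_times_k.
elim: m => [_|m IH mk]; first by rewrite big_ord0 nth_times0.
by rewrite big_ord_recr /= IH ?(ltnW mk) // gapE.
Qed.

Lemma unselected_between i t : (i < k)%N -> (nth n T i < t)%N ->
  (t < nth n T i.+1)%N -> go t \notin w.1.
Proof.
move=> ik it ti; apply/negP => tw.
have tn : (t < n)%N.
  apply: leq_trans ti _; have [jk|jk] := ltnP i.+1 k; first by rewrite ltnW // nth_times_lt.
  by rewrite nth_default ?size_times.
have : t \in T by rewrite mem_times tn.
case/(nthP n) => j; rewrite size_times => jk jt; move: it ti; rewrite -jt => h1 h2.
have [ji|ij] := leqP j i.
  move: ji; rewrite leq_eqVlt => /orP[/eqP ji|ji]; first by rewrite ji ltnn in h1.
  by have := ltn_trans h1 (nth_times_mono ji (ltnW ik)); rewrite ltnn.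
move: ij; rewrite leq_eqVlt => /orP[/eqP ji|ji]; first by rewrite ji ltnn in h2.
by have := ltn_trans h2 (nth_times_mono ji (ltnW jk)); rewrite ltnn.
Qed.

Lemma selected_tailsE : selected_tails w = [seq go t | t <- T].
Proof.
rewrite /selected_tails /times.
have -> : traject (@ordS n) w.2 n = [seq go t | t <- iota 0 n].
  apply: (@eq_from_nth _ w.2); first by rewrite size_traject size_map size_iota.
  move=> i; rewrite size_traject => ilt.
  by rewrite nth_traject // (nth_map 0%N) ?size_iota // nth_iota.
by rewrite filter_map.
Qed.

Lemma e_E i : (i < k)%N -> e_ w i = go (nth n T i).
Proof.
by move=> ik; rewrite /e_ selected_tailsE (nth_map n) ?size_times.
Qed.

Lemma e_mem i : (i < k)%N -> e_ w i \in w.1.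
Proof. by move=> ik; rewrite e_E // nth_times_mem. Qed.

Lemma e_inj i j : (i < k)%N -> (j < k)%N -> e_ w i = e_ w j -> i = j.
Proof.
move=> ik jk; rewrite !e_E // => /iter_ordS_inj e.
have {}e := e (nth_times_lt ik) (nth_times_lt jk).
by case: (ltngtP i j) => // ij;
  have := nth_times_mono ij (ltnW _); rewrite e ltnn => /(_ ltac:(done)).
Qed.

Lemma e_surj x : x \in w.1 -> exists2 i, (i < k)%N & x = e_ w i.
Proof.
rewrite set_of_times inE => /mapP[t tT ->].
case/(nthP n): tT => i; rewrite size_times => ik <-.
by exists i; rewrite // e_E.
Qed.

Section Matrix.
Variables (R : realType) (A : 'M[R]_k).
Local Notation H := (reconnected_cycle A w).

Lemma reconnected_unselected z x : x \notin w.1 -> H z (ordS x) = (z == x)%:R.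
Proof.
move=> xw; rewrite mxE (inj_eq (@ordS_inj n)) big1 => [|i _].
  rewrite addr0 eq_sym; case: eqP => [->|]; by rewrite ?xw ?andbF.
rewrite big_pred0 // => j; rewrite /b_next (inj_eq (@ordS_inj n)).
case: (x =P _) => [xe|]; last by rewrite andbF.
by move: xw; rewrite xe e_mem.
Qed.

Lemma reconnected_selected z (i : 'I_k) :
  H z (ordS (e_ w i)) = \sum_(j < k | z == e_ w j) A i j.
Proof.
rewrite mxE (inj_eq (@ordS_inj n)).
have -> : (z \notin w.1) && (e_ w i == z) = false.
  by apply/negP => /andP[zw /eqP ez]; rewrite -ez e_mem in zw.
rewrite add0r (bigD1 i) //= [X in _ + X]big1 ?addr0 => [|l li].
  by apply: eq_bigl => j; rewrite /b_next eqxx andbT.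
rewrite big_pred0 // => j; rewrite /b_next (inj_eq (@ordS_inj n)).
case: (e_ w i =P e_ w l) => [il|]; last by rewrite andbF.
by move: li; rewrite -val_eqE /= (e_inj (ltn_ord i) (ltn_ord l) il) eqxx.
Qed.

Section Eigen.
Variables (mu : R[i]) (v : 'rV[R[i]]_n).
Hypothesis vH : v *m map_mx (real_complex R) H = mu *: v.
Local Notation F t := (v 0 (go t)).

Lemma eigen_unselected t : go t \notin w.1 -> mu * F t.+1 = F t.
Proof.
move=> tw; move/rowP: vH => /(_ (go t.+1)); rewrite !mxE => <-.
rewrite (bigD1 (go t)) //= big1 ?addr0 => [|z zt].
  by rewrite mxE reconnected_unselected // eqxx rmorph1 mulr1.
by rewrite mxE reconnected_unselected // (negPf zt) rmorph0 mulr0.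
Qed.

Lemma eigen_selected (i : 'I_k) :
  mu * F (nth n T i).+1 = \sum_j toC (A i j) * F (nth n T j).
Proof.
move/rowP: vH => /(_ (go (nth n T i).+1)); rewrite !mxE => <-.
rewrite iterS -e_E //.
under eq_bigr => z _ do rewrite mxE reconnected_selected rmorph_sum mulr_sumr big_mkcond /=.
rewrite exchange_big /=; apply: eq_bigr => j _.
rewrite (bigD1 (e_ w j)) //= eqxx big1 ?addr0 => [|z /negPf -> //].
by rewrite mulrC e_E.
Qed.

(** One use of the reconnected edges, then g - 1 steps along the cycle. *)
Lemma eigen_segment (i : 'I_k) g : (0 < g)%N -> (g <= gap w i)%N ->
  mu ^+ g * F (nth n T i + g)%N = \sum_j toC (A i j) * F (nth n T j).
Proof.
case: g => // g _; elim: g => [_|g IH gle].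
  by rewrite expr1 addn1 eigen_selected.
rewrite exprSr -mulrA addnS eigen_unselected ?IH ?(ltnW gle) //.
apply: (@unselected_between i) => //; first by rewrite addnS ltnS leq_addr.
by rewrite -gapE // ltn_add2l.
Qed.

Lemma eigen_gap (i : 'I_k) :
  \sum_j toC (A i j) * F (nth n T j) = mu ^+ gap w i * F (nth n T (ordS i)).
Proof.
rewrite -(eigen_segment (gap_gt0 (ltn_ord i)) (leqnn _)) gapE //.
congr (_ * v 0 _); have := ltn_ord i; rewrite leq_eqVlt => /orP[/eqP ik|ik].
  have -> : nth n T i.+1 = n by rewrite ik nth_times_k.
  have -> : nth n T (ordS i) = 0%N by rewrite /= ik modnn nth_times0.
  exact: iter_ordS_n.
by rewrite /= modn_small.
Qed.

(** If v vanishes at all the selected tails, it vanishes everywhere by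
    propagation along the cycle. *)
Lemma eigen_neq0 : mu != 0 -> v != 0 -> exists i : 'I_k, F (nth n T i) != 0.
Proof.
move=> mu0 v0; apply/existsP; rewrite -[X in is_true X]negbK; apply/negP.
rewrite negb_exists => /forallP F0.
have {}F0 (i : 'I_k) : F (nth n T i) = 0 by apply/eqP; rewrite -[_ == _]negbK F0.
move/eqP: v0; apply; apply/rowP => x; rewrite mxE.
have [t _ <-] := iter_ordS_surj w.2 x.
elim: t => [|t IH]; first by have := F0 (Ordinal outcome_gt0); rewrite /= nth_times0.
apply: (mulfI mu0); rewrite mulr0.
have [/e_surj[i ik te]|tw] := boolP (go t \in w.1); last by rewrite eigen_unselected.
rewrite iterS te e_E // -iterS (eigen_selected (Ordinal ik)).
by apply: big1 => j _; rewrite F0 mulr0.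
Qed.

End Eigen.

(** An unselected vertex carries no loop. This is what makes the reconnected
    cycle have an eigenvalue other than 1, without which the infimum defining
    its spectral gap would be the infimum of the empty set. *)
Lemma trace_reconnected_lt : doubly_stochastic A -> (k < n)%N -> \tr H < n%:R.
Proof.
move=> [A0 Ar Ac] kn.
have n_gt1 : (1 < n)%N by apply: leq_ltn_trans kn; exact: outcome_gt0.
apply: (@le_lt_trans _ _ k%:R); last by rewrite ltr_nat.
have -> : k%:R = \sum_(x in w.1) 1 :> R by rewrite sumr_const cardw.
rewrite [leRHS]big_mkcond /=; apply: ler_sum => x _.
have [/e_surj[j jk xe]|xw] := ifPn.
  rewrite mxE xe e_mem //= add0r -(Ac (Ordinal jk)); apply: ler_sum => i _.
  rewrite big_mkcond (bigD1 (Ordinal jk)) //= big1 ?addr0 => [|l lj].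
    by case: ifP.
  case: (e_ w j =P e_ w l) => //= /(e_inj jk (ltn_ord l)) jl.
  by move: lj; rewrite -val_eqE /= jl eqxx.
rewrite mxE xw /= big1 => [|i _]; last first.
  rewrite big_pred0 // => j; case: (x =P _) => //= xe.
  by move: xw; rewrite xe e_mem.
rewrite addr0; have -> // : (x == ordS x) = false.
by apply/negP => /eqP /(iter_ordS_inj (s := 0) (t := 1) n_gt0 n_gt1).
Qed.

End Matrix.
End Times.

Lemma gap_inj (n k : nat) (w w' : {set 'I_n} * 'I_n) :
  w \in outcomes n k -> w' \in outcomes n k -> w.2 = w'.2 ->
  (forall i, (i < k)%N -> gap w i = gap w' i) -> w = w'.
Proof.
move=> wP w'P e2 eg.
have ET : times w = times w'.
  apply: (@eq_from_nth _ n); first by rewrite (size_times wP) (size_times w'P).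
  move=> i; rewrite (size_times wP).
  elim: i => [|i IH] ik; first by rewrite (nth_times0 wP) (nth_times0 w'P).
  rewrite -(gapE wP) ?(ltnW ik) // -(gapE w'P) ?(ltnW ik) //.
  by rewrite IH ?(ltnW ik) // eg // ltnW.
case: w w' wP w'P e2 eg ET => [S v] [S' v'] wP w'P /= e2 _ ET.
congr pair => //; rewrite [LHS](set_of_times (S, v)) [RHS](set_of_times (S', v')).
by rewrite ET /= e2.
Qed.

(** * Gaps against independent geometric variables *)

Lemma card_outcomes n k : #|outcomes n k| = (k * 'C(n, k))%N.
Proof.
rewrite -sum1_card.
rewrite (eq_bigl (fun w : {set 'I_n} * 'I_n => (#|w.1| == k) && (w.2 \in w.1))); last first.
  by move=> w; rewrite inE.
rewrite -(pair_big_dep (fun S : {set 'I_n} => #|S| == k) (fun S v => v \in S)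
  (fun _ _ => 1%N)) /=.
rewrite (eq_bigr (fun=> k)) => [|S /eqP Sk]; last by rewrite sum1_card.
rewrite sum_nat_const mulnC -[n in RHS](card_ord n) -card_draws; congr (_ * _)%N.
by apply: eq_card => S; rewrite inE.
Qed.

(** k is a mode of the binomial law with parameters n and k / n. Denominators
    are cleared: the probability of j is the left-hand side divided by n ^ n. *)
Lemma binomial_mode n k j : (k < n)%N -> (j <= n)%N ->
  ('C(n, j) * (k ^ j * (n - k) ^ (n - j)) <= 'C(n, k) * (k ^ k * (n - k) ^ (n - k)))%N.
Proof.
move=> kn jn.
pose g i := ('C(n, i) * (k ^ i * (n - k) ^ (n - i)))%N.
(* The ratio g i.+1 / g i is (n - i) k / ((i + 1) (n - k)). *)
have up i : (i < k)%N -> (g i <= g i.+1)%N.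
  move=> ik; have E : (n - i = (n - i.+1).+1)%N by lia.
  rewrite /g E !expnS; set P := ((n - k) ^ _)%N; set Q := (k ^ i)%N; set m := (n - k)%N.
  suff H : ('C(n, i) * (n - k) <= 'C(n, i.+1) * k)%N.
    have := leq_mul H (leqnn (Q * P)).
    by congr (_ <= _)%N; rewrite /m; ring.
  rewrite -(leq_pmul2l (ltn0Sn i)) !mulnA mul_bin_left.
  have : ((n - k) * i.+1 <= (n - i) * k)%N by apply: leq_mul => //; lia.
  by nia.
have down i : (k <= i)%N -> (i < n)%N -> (g i.+1 <= g i)%N.
  move=> ik iN; have E : (n - i = (n - i.+1).+1)%N by lia.
  rewrite /g E !expnS; set P := ((n - k) ^ _)%N; set Q := (k ^ i)%N; set m := (n - k)%N.
  suff H : ('C(n, i.+1) * k <= 'C(n, i) * (n - k))%N.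
    have := leq_mul H (leqnn (Q * P)).
    by congr (_ <= _)%N; rewrite /m; ring.
  rewrite -(leq_pmul2l (ltn0Sn i)) !mulnA mul_bin_left.
  have : ((n - i) * k <= i.+1 * (n - k))%N by rewrite mulnC; apply: leq_mul; lia.
  by nia.
have [jk|kj] := leqP j k.
  have : forall d, (d <= k)%N -> (g (k - d) <= g k)%N.
    elim=> [|d IH dk]; first by rewrite subn0.
    apply: leq_trans (IH (ltnW dk)).
    have -> : (k - d = (k - d.+1).+1)%N by lia.
    by apply: up; lia.
  by move=> /(_ (k - j)%N (leq_subr _ _)); rewrite subKn.
elim: j jn kj => // j IH jn; rewrite ltnS leq_eqVlt => /orP[/eqP e|kj].
  by have := down j; rewrite -e leqnn; apply.
exact: leq_trans (down j (ltnW kj) jn) (IH (ltnW jn) kj).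
Qed.

(** The n + 1 probabilities of the binomial law add up to 1 and the one of k is
    the largest. *)
Lemma binomial_mode_mass n k : (k < n)%N ->
  (n ^ n <= n.+1 * ('C(n, k) * (k ^ k * (n - k) ^ (n - k))))%N.
Proof.
move=> kn; rewrite -{1}(subnK (ltnW kn)) expnDn.
rewrite -[X in (_ <= X * _)%N]card_ord -sum_nat_const; apply: leq_sum => j _.
by rewrite [((n - k) ^ _ * _)%N]mulnC binomial_mode // -ltnS.
Qed.

Section ConditionedGeometric.
Variables (R : realType) (n k : nat).
Hypothesis k_gt0 : (0 < k)%N.
Hypothesis kn : (k < n)%N.
Let p : R := k%:R / n%:R.
Let x : R := 1 - p.

Let n_gt0 : 0 < n%:R :> R. Proof. by rewrite ltr0n (leq_trans _ kn). Qed.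
Let xE : x = (n - k)%:R / n%:R.
Proof. by rewrite natrB ?(ltnW kn) // mulrBl divff // gt_eqF. Qed.
Let x_gt0 : 0 < x. Proof. by rewrite xE divr_gt0 // ltr0n subn_gt0. Qed.
Let p_gt0 : 0 < p. Proof. by rewrite divr_gt0 // ltr0n. Qed.

Lemma mode_mass_ge1 : 1 <= n.+1%:R * 'C(n, k)%:R * p ^+ k * x ^+ (n - k).
Proof.
rewrite xE !expr_div_n.
have nn : 0 < n%:R ^+ n :> R by rewrite exprn_gt0.
rewrite -(ler_pM2r nn) mul1r.
have := binomial_mode_mass kn; rewrite -(ler_nat R) !natrM !natrX => H.
apply: le_trans H _; rewrite le_eqVlt; apply/orP; left; apply/eqP.
have -> : n%:R ^+ n = n%:R ^+ k * n%:R ^+ (n - k) :> R by rewrite -exprD subnKC ?(ltnW kn).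
have nk : n%:R != 0 :> R by rewrite gt_eqF.
have a0 : n%:R ^+ k != 0 :> R by rewrite expf_neq0.
have b0 : n%:R ^+ (n - k) != 0 :> R by rewrite expf_neq0.
by field; apply/andP.
Qed.

(** Comparison of the gaps with k independent geometric variables of parameter
    p = k / n. An outcome is determined by its first tail and its gaps, and the
    product of the geometric weights p x ^ (l - 1) of gaps with sum n is always
    p ^ k x ^ (n - k). So the sum over outcomes is a sum over some points of
    'I_n times a product space, which factorises once it is extended to the
    whole product space. By [mode_mass_ge1], #|outcomes n k| p ^ k x ^ (n - k)
    is at least k / (n + 1), and there are n possible first tails: hence the
    factor (n / k) (n + 1). *)
Lemma sum_prod_gaps (phi : 'I_k -> nat -> R) : (forall i l, 0 <= phi i l) ->
  \sum_(w in outcomes n k) \prod_(i < k) phi i (gap w i) <=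
  n%:R / k%:R * n.+1%:R * #|outcomes n k|%:R *
  \prod_(i < k) \sum_(l < n) p * x ^+ l * phi i l.+1.
Proof.
move=> phi0.
pose Phi i l := x ^+ l * phi i l.+1.
have Phi0 i l : 0 <= Phi i l by rewrite mulr_ge0 // exprn_ge0 // ltW.
(* The default value w.2 of insubd is never used: a gap lies between 1 and n. *)
pose enc (w : {set 'I_n} * 'I_n) : 'I_n * {ffun 'I_k -> 'I_n} :=
  (w.2, [ffun i : 'I_k => insubd w.2 (gap w i).-1]).
have encE w (i : 'I_k) : w \in outcomes n k -> ((enc w).2 i).+1 = gap w i.
  move=> wP; rewrite ffunE val_insubd.
  have := gap_gt0 wP (ltn_ord i); have := gap_le_n wP i.
  by case: (gap w i) => // g gn _ /=; rewrite gn.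
have enc_inj : {in outcomes n k &, injective enc}.
  move=> w w' wP w'P e; apply: (gap_inj wP w'P); first by case: e.
  by move=> i ik; rewrite -(encE w (Ordinal ik)) // -(encE w' (Ordinal ik)) // e.
pose G (y : 'I_n * {ffun 'I_k -> 'I_n}) := \prod_(i < k) Phi i (y.2 i).
have sumG : \sum_(w in outcomes n k) G (enc w) <= n%:R * \prod_(i < k) \sum_(l < n) Phi i l.
  rewrite -(big_imset G enc_inj) /=.
  have G0 y : 0 <= G y by apply: prodr_ge0.
  apply: (@le_trans _ _ (\sum_y G y)).
    rewrite [leRHS](bigID (mem (enc @: outcomes n k))) /= lerDl.
    by apply: sumr_ge0.
  rewrite -(pair_bigA _ (fun v (g : {ffun 'I_k -> 'I_n}) => \prod_(i < k) Phi i (g i))) /=.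
  by rewrite sumr_const card_ord (bigA_distr_bigA (fun i (l : 'I_n) => Phi i l)) mulr_natl.
have GE w : w \in outcomes n k ->
    G (enc w) = x ^+ (n - k) * \prod_(i < k) phi i (gap w i).
  move=> wP; rewrite /G big_split /=; congr (_ * _); last first.
    by apply: eq_bigr => i _; rewrite encE.
  rewrite -expr_sum; congr (_ ^+ _).
  have E : (\sum_(i < k) (enc w).2 i + k = n)%N.
    transitivity (\sum_(i < k) gap w i)%N; last exact: sum_gap.
    rewrite [RHS](eq_bigr (fun i => (enc w).2 i + 1)%N) => [|i _]; last by rewrite addn1 encE.
    by rewrite big_split /= sum1_card card_ord.
  by move: E; set s := (\sum_(i < k) _)%N; lia.
have xnk : 0 < x ^+ (n - k) by rewrite exprn_gt0.
rewrite -(ler_pM2l xnk) mulr_sumr -(eq_bigr _ GE).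
apply: le_trans sumG _.
have -> : \prod_(i < k) \sum_(l < n) p * x ^+ l * phi i l.+1 =
    p ^+ k * \prod_(i < k) \sum_(l < n) Phi i l.
  rewrite -[in p ^+ k](card_ord k) -prodr_const -big_split /=.
  by apply: eq_bigr => i _; rewrite mulr_sumr; apply: eq_bigr => l _; rewrite mulrA.
set Q := \prod_(i < k) _.
have Q0 : 0 <= Q by apply: prodr_ge0 => i _; apply: sumr_ge0.
rewrite card_outcomes natrM.
have k0 : k%:R != 0 :> R by rewrite pnatr_eq0 -lt0n.
have -> : x ^+ (n - k) * (n%:R / k%:R * n.+1%:R * (k%:R * 'C(n, k)%:R) * (p ^+ k * Q))
  = (n.+1%:R * 'C(n, k)%:R * p ^+ k * x ^+ (n - k)) * (n%:R * Q) by field.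
by rewrite ler_peMl ?mode_mass_ge1 // mulr_ge0.
Qed.

(** The bound is the probability that a geometric variable exceeds M. *)
Lemma geometric_tail M : \sum_(l < n) p * x ^+ l * (M <= l)%N%:R <= x ^+ M.
Proof.
have x1 : x <= 1 by rewrite gerBl ltW.
suff H m : \sum_(l < m) p * x ^+ l * (M <= l)%N%:R <=
    (if (M <= m)%N then x ^+ M - x ^+ m else 0).
  apply: le_trans (H n) _; case: ifP => _; last by rewrite exprn_ge0 // ltW.
  by rewrite gerBl exprn_ge0 // ltW.
elim: m => [|m IH]; first by rewrite big_ord0; case: M => //; rewrite subrr.
rewrite big_ord_recr /= (leq_eqVlt M m.+1); case: (leqP M m) IH => Mm IH.
  rewrite mulr1 (_ : _ || _ = true) ?ltnS ?Mm ?orbT // exprS.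
  have -> : x * x ^+ m = x ^+ m - p * x ^+ m by rewrite {1}/x mulrBl mul1r.
  by lra.
rewrite mulr0 addr0; case: ifP => // /orP[/eqP Me|]; first by rewrite Me subrr -Me.
by rewrite ltnS leqNgt Mm.
Qed.

End ConditionedGeometric.

(** * Two rare events: a long gap, aligned phases *)

Section UnitCircle.
Variable R : realType.
Implicit Types (u z : R[i]).

Lemma sqnB1_unit z : sqn z = 1 -> sqn (z - 1) = 2 - 2 * complex.Re z.
Proof.
case: z => a b; rewrite /sqn /= => h.
transitivity (a ^+ 2 + b ^+ 2 + 1 - 2 * a); first by ring.
by rewrite h; ring.
Qed.

Lemma sqn_unit_le4 z : sqn z = 1 -> sqn (z - 1) <= 4.
Proof. by move=> h; have := sqnB_le z 1; rewrite h sqn1; lra. Qed.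

Lemma Re_ge_neg1 z : sqn z <= 1 -> -1 <= complex.Re z.
Proof. by case: z => a b; rewrite /sqn /=; have := sqr_ge0 b; nra. Qed.

(** u ^ g - v ^ g is u - v times a sum of g terms of modulus 1. *)
Lemma sqnX_sub u v g : sqn u = 1 -> sqn v = 1 ->
  sqn (u ^+ g - v ^+ g) <= g%:R ^+ 2 * sqn (u - v).
Proof.
move=> u1 v1; rewrite subrXX sqnM mulrC ler_wpM2r ?sqn_ge0 //.
have n1 (z : R[i]) : sqn z = 1 -> normc z = 1.
  by move=> h; apply/eqP; rewrite -sqrp_eq1 ?normc_ge0 // -sqn_normc h.
rewrite sqn_normc ler_sqr ?nnegrE ?normc_ge0 //.
apply: le_trans (normc_sum _ _ _) _.
rewrite (eq_bigr (fun=> 1)) ?sumr_const ?card_ord // => i _.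
by rewrite normcM !normcX !n1 // !expr1n mulr1.
Qed.

(** With x = 1 - p, the mean of u ^ l for l geometric is z = p u / (1 - x u), and
    |u ^ l - 1| ^ 2 = 2 - 2 Re (u ^ l) turns the sum into 3/4 + Re z / 4, up to
    the truncation at n, which has the favourable sign because |z| <= 1.
    Finally 1 - Re z = (1 + x) d / (2 (p ^ 2 + x d)) with d = |u - 1| ^ 2. *)
Lemma geometric_phase (p : R) u n : 0 < p -> p < 1 -> sqn u = 1 ->
  \sum_(l < n) p * (1 - p) ^+ l * (1 - sqn (u ^+ l.+1 - 1) / 8) <=
  1 - sqn (u - 1) / (8 * (p ^+ 2 + sqn (u - 1))).
Proof.
move=> p0 p1 u1; set x := 1 - p.
have x0 : 0 < x by rewrite subr_gt0.
have x1 : x <= 1 by rewrite gerBl ltW.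
have d0 : 0 <= sqn (u - 1) by apply: sqn_ge0.
have dE := sqnB1_unit u1; set d := sqn (u - 1) in d0 dE *.
pose y : R[i] := 1 - toC x * u.
have yE : sqn y = p ^+ 2 + x * d.
  rewrite dE /y; case: (u) u1 => c s; rewrite /sqn /= => h.
  rewrite /x; transitivity (1 - 2 * (1 - p) * c + (1 - p) ^+ 2 * (c ^+ 2 + s ^+ 2)); first by ring.
  by rewrite h; ring.
have y0 : y != 0.
  rewrite -sqn_eq0 yE gt_eqF // ltr_wpDr ?exprn_gt0 // mulr_ge0 //; exact: ltW.
have [z zy] : exists z, z * y = toC p * u by exists (toC p * u / y); rewrite divfK.
have Yp : 0 < sqn y by rewrite lt_def sqn_eq0 y0 sqn_ge0.
have z1 : sqn z <= 1.
  rewrite -(ler_pM2r Yp) -sqnM zy sqnM sqn_toC u1 mulr1 mul1r yE.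
  by rewrite lerDl mulr_ge0 // ltW.
have Rez : 1 - complex.Re z = (1 + x) * d / 2 / (p ^+ 2 + x * d).
  have D0 : p ^+ 2 + x * d != 0 by rewrite -yE gt_eqF.
  apply: (mulIf D0); rewrite divfK // -yE.
  move: zy; rewrite dE /y /x; case: (z) => a b; case: (u) u1 => c s.
  rewrite /sqn /= => h /eqP; rewrite eq_complex /= => /andP[/eqP e1 /eqP e2].
  have : a * ((1 - (1 - p) * c) ^+ 2 + ((1 - p) * s) ^+ 2) =
     (1 - (1 - p) * c) * (p * c - 0 * s) - (1 - p) * s * (p * s + 0 * c).
    rewrite -e1 -e2; ring.
  have s2 : s ^+ 2 = 1 - c ^+ 2 by rewrite -h; ring.
  move=> e3; rewrite mulrBl.
  have -> : a * ((1 - ((1 - p) * c - 0 * s)) ^+ 2 + (0 - ((1 - p) * s + 0 * c)) ^+ 2) =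
     a * ((1 - (1 - p) * c) ^+ 2 + ((1 - p) * s) ^+ 2) by ring.
  rewrite e3; apply/eqP; rewrite -subr_eq0; apply/eqP.
  transitivity ((s ^+ 2 - (1 - c ^+ 2)) * ((1 - p) ^+ 2 + (1 - p) * p)); first by field.
  by rewrite s2 subrr mul0r.
(* Partial sums of the geometric series with ratio x u. *)
have sumE m : \sum_(l < m) toC (p * x ^+ l) * u ^+ l.+1 = z - toC (x ^+ m) * u ^+ m * z.
  elim: m => [|m IH]; first by rewrite big_ord0 !expr0 rmorph1 !mul1r subrr.
  rewrite big_ord_recr /= IH; apply: (mulIf y0).
  rewrite mulrDl !mulrBl -!mulrA zy !exprS !rmorphM.
  by rewrite /y; ring.
have termE (l : nat) : p * x ^+ l * (1 - sqn (u ^+ l.+1 - 1) / 8) =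
    3 / 4 * (p * x ^+ l) + 4^-1 * complex.Re (toC (p * x ^+ l) * u ^+ l.+1).
  rewrite sqnB1_unit ?sqnX ?u1 ?expr1n //.
  by case: (u ^+ l.+1) => a b /=; field.
rewrite (eq_bigr _ (fun (l : 'I_n) _ => termE l)) big_split /= -!mulr_sumr -raddf_sum /= sumE.
have geo : p * \sum_(l < n) x ^+ l = 1 - x ^+ n.
  have := subrX1 x n; rewrite {2}/x => e; apply: oppr_inj.
  by rewrite opprB e -mulNr; congr (_ * _); ring.
rewrite geo.
have Rw : -1 <= complex.Re (u ^+ n * z).
  by apply: Re_ge_neg1; rewrite sqnM sqnX u1 expr1n mul1r.
have ReE : complex.Re (z - toC (x ^+ n) * u ^+ n * z) =
    complex.Re z - x ^+ n * complex.Re (u ^+ n * z).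
  by rewrite -mulrA; case: (u ^+ n * z) => a b; case: (z) => e f /=; ring.
rewrite ReE.
have xn0 : 0 <= x ^+ n by rewrite exprn_ge0 // ltW.
have low : d / (2 * (p ^+ 2 + d)) <= 1 - complex.Re z.
  rewrite Rez -mulrA -invfM.
  have Q1 : 0 < p ^+ 2 + d by rewrite ltr_wpDr ?exprn_gt0.
  have Q2 : 0 < p ^+ 2 + x * d by rewrite -yE.
  rewrite ler_pdivrMr ?mulr_gt0 // mulrAC ler_pdivlMr ?mulr_gt0 //.
  have pp : 0 < p ^+ 2 by rewrite exprn_gt0.
  have xd : 0 <= x * d by rewrite mulr_ge0 // ltW.
  have : 0 <= x * d * (p ^+ 2 + d) by rewrite mulr_ge0 // ltW.
  have : 0 <= d * ((1 - x) * d) by rewrite !mulr_ge0 // subr_ge0.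
  by nra.
have -> : d / (8 * (p ^+ 2 + d)) = 4^-1 * (d / (2 * (p ^+ 2 + d))).
  have Q1 : p ^+ 2 + d != 0 by rewrite gt_eqF // ltr_wpDr ?exprn_gt0.
  by field.
have : 0 <= x ^+ n * (1 + complex.Re (u ^+ n * z)) by rewrite mulr_ge0 //; lra.
nra.
Qed.

End UnitCircle.

Section Bounds.
Variables (R : realType) (n k : nat).
Hypothesis k_gt0 : (0 < k)%N.
Hypothesis kn : (k < n)%N.
Let p : R := k%:R / n%:R.

Let n_gt0 : 0 < n%:R :> R. Proof. by rewrite ltr0n (leq_trans _ kn). Qed.
Let k_gt0R : 0 < k%:R :> R. Proof. by rewrite ltr0n. Qed.
Let p_gt0 : 0 < p. Proof. by rewrite divr_gt0. Qed.
Let p_lt1 : p < 1. Proof. by rewrite ltr_pdivrMr // mul1r ltr_nat. Qed.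
Let x_ge0 : 0 <= 1 - p. Proof. by rewrite subr_ge0 ltW. Qed.

Lemma card_le_sum (W : finType) (S : {set W}) (E : pred W) (X : W -> R) :
  (forall w, 0 <= X w) -> (forall w, w \in S -> E w -> 1 <= X w) ->
  #|[set w in S | E w]%SET|%:R <= \sum_(w in S) X w.
Proof.
move=> X0 X1; rewrite -sum1_card natr_sum.
rewrite [leRHS](bigID E) /= ler_wpDr ?sumr_ge0 //.
rewrite (eq_bigl (fun w => (w \in S) && E w)); last by move=> w; rewrite !inE.
by apply: ler_sum => w /andP[]; exact: X1.
Qed.

(** Union bound over the k gaps, with a weight that tests a single gap. *)
Lemma card_long_gap M :
  #|[set w in outcomes n k | [exists i : 'I_k, (M < gap w i)%N]]%SET|%:R <=
  n%:R * n.+1%:R * (1 - p) ^+ M * #|outcomes n k|%:R.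
Proof.
pose phi (i j : 'I_k) (l : nat) : R := if j == i then (M < l)%N%:R else 1.
have phi0 i j l : 0 <= phi i j l by rewrite /phi; case: ifP.
apply: (@le_trans _ _ (\sum_(w in outcomes n k)
    \sum_(i < k) \prod_(j < k) phi i j (gap w j))).
  apply: card_le_sum => w; first by apply: sumr_ge0 => i _; apply: prodr_ge0.
  move=> _ /existsP[i Mi]; rewrite (bigD1 i) //= ler_wpDr ?sumr_ge0 //.
    by move=> j _; apply: prodr_ge0.
  rewrite big1 // => j _; rewrite /phi; case: eqP => // ->; by rewrite Mi.
rewrite exchange_big /=.
have B i : \sum_(w in outcomes n k) \prod_(j < k) phi i j (gap w j) <=
    n%:R / k%:R * n.+1%:R * #|outcomes n k|%:R * (1 - p) ^+ M.
  apply: le_trans (sum_prod_gaps k_gt0 kn (phi0 i)) _.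
  apply: ler_wpM2l; first by rewrite !mulr_ge0 ?invr_ge0.
  rewrite (bigD1 i) //= -[leRHS]mulr1; apply: ler_pM.
  - by apply: sumr_ge0 => l _; rewrite !mulr_ge0 ?exprn_ge0 // ltW.
  - by apply: prodr_ge0 => j _; apply: sumr_ge0 => l _; rewrite !mulr_ge0 ?exprn_ge0 // ltW.
  - by rewrite /phi eqxx; exact: geometric_tail.
  - apply: prodr_ile1 => j ji; apply/andP; split.
      by apply: sumr_ge0 => l _; rewrite !mulr_ge0 ?exprn_ge0 // ltW.
    by rewrite /phi (negPf ji); have := @geometric_tail R n k k_gt0 kn 0.
apply: le_trans (ler_sum _ (fun i _ => B i)) _.
rewrite sumr_const card_ord -mulr_natl le_eqVlt; apply/orP; left; apply/eqP.
by field; rewrite gt_eqF.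
Qed.

(** Squares of side 1 / K that cover the unit circle: picking one point per
    occupied square gives a net without using angles. *)
Let cell (K : nat) (u : R[i]) : nat * nat :=
  (Num.truncn ((complex.Re u + 1) * K%:R), Num.truncn ((complex.Im u + 1) * K%:R)).

Lemma cell_lt K u : sqn u = 1 -> ((cell K u).1 < (2 * K).+1)%N && ((cell K u).2 < (2 * K).+1)%N.
Proof.
case: u => a b; rewrite /sqn /= => h.
have ha : a <= 1 by have := sqr_ge0 b; nra.
have hb : b <= 1 by have := sqr_ge0 a; nra.
have ha' : -1 <= a by have := sqr_ge0 b; nra.
have hb' : -1 <= b by have := sqr_ge0 a; nra.
have H (t : R) : -1 <= t -> t <= 1 -> (Num.truncn ((t + 1) * K%:R) < (2 * K).+1)%N.
  move=> t1 t2; have t0 : 0 <= (t + 1) * K%:R by rewrite mulr_ge0 //; lra.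
  rewrite truncn_lt_nat // -natr1 natrM.
  apply: le_lt_trans (_ : 2 * K%:R < _); last by rewrite ltrDl.
  by rewrite ler_wpM2r //; lra.
by rewrite !H.
Qed.

Lemma cell_close K u v : (0 < K)%N -> sqn u = 1 -> sqn v = 1 -> cell K u = cell K v ->
  sqn (u - v) <= 2 / K%:R ^+ 2.
Proof.
case: u => a b; case: v => c d; rewrite /sqn /= => K0 h1 h2 [e1 e2].
have K0R : 0 < K%:R :> R by rewrite ltr0n.
have H (s t : R) : -1 <= s -> -1 <= t ->
    Num.truncn ((s + 1) * K%:R) = Num.truncn ((t + 1) * K%:R) ->
    (s - t) ^+ 2 <= 1 / K%:R ^+ 2.
  move=> s1 t1 e; rewrite ler_pdivlMr ?exprn_gt0 // -exprMn.
  have s0 : 0 <= (s + 1) * K%:R by rewrite mulr_ge0 //; lra.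
  have t0 : 0 <= (t + 1) * K%:R by rewrite mulr_ge0 //; lra.
  have /andP[a1 a2] := truncn_itv s0; have /andP[b1 b2] := truncn_itv t0.
  move: a1 a2 b1 b2; rewrite e -natr1.
  set N := (Num.truncn _)%:R => a1 a2 b1 b2.
  have l1 : (s - t) * K%:R <= 1 by lra.
  have l2 : -1 <= (s - t) * K%:R by lra.
  nra.
have ha' : -1 <= a by have := sqr_ge0 b; nra.
have hb' : -1 <= b by have := sqr_ge0 a; nra.
have hc' : -1 <= c by have := sqr_ge0 d; nra.
have hd' : -1 <= d by have := sqr_ge0 c; nra.
have := H a c ha' hc' e1; have := H b d hb' hd' e2; lra.
Qed.

(** 1 - s / 8 >= exp (- s / 4) for 0 <= s <= 4: the product of the weights is not
    small when the phases are nearly aligned. *)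
Lemma expR_le_prod (s : 'I_k -> R) : (forall i, 0 <= s i <= 4) ->
  expR (- (\sum_i s i) / 4) <= \prod_i (1 - s i / 8).
Proof.
move=> s04; rewrite mulNr -mulrN mulr_suml expR_sum.
apply: ler_prod => i _; rewrite expR_ge0 /= mulrN expRN.
have /andP[s0 s4] := s04 i.
have q : 0 < 1 - s i / 8 by lra.
rewrite -[leRHS]invrK lef_pV2 ?posrE ?invr_gt0 ?expR_gt0 //.
apply: le_trans (expR_ge1Dx _).
rewrite -[leLHS]mul1r ler_pdivrMr //; nra.
Qed.

(** Union bound over a net. Each occupied square of side 1 / K gets a
    representative v, itself on the circle and away from 1. If the phases of
    some u in the square are aligned then so are those of v, up to a multiple of
    n / K in each phase, and then \prod_i (1 - |v ^ gap_i - 1| ^ 2 / 8) is at least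
    exp (- sigma). By [sum_prod_gaps] and [geometric_phase] the mean of this
    product is exponentially small in k. *)
Lemma card_aligned_phases (K : nat) (theta tau : R) : (0 < K)%N -> 0 < theta ->
  #|[set w in outcomes n k | `[< exists u : R[i], [/\ sqn u = 1, theta <= sqn (u - 1) &
      \sum_(i < k) sqn (u ^+ gap w i - 1) <= tau * k%:R] >]]%SET|%:R <=
  (2 * K).+1%:R ^+ 2 * (n%:R / k%:R * n.+1%:R)
  * expR ((2 * tau + 4 * n%:R ^+ 2 / K%:R ^+ 2) * k%:R / 4)
  * (1 - theta / (8 * (p ^+ 2 + theta))) ^+ k * #|outcomes n k|%:R.
Proof.
move=> K0 th0.
set sigma := (_ * k%:R / 4); set q := 1 - _.
have p20 : 0 < p ^+ 2 by rewrite exprn_gt0.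
have q0 : 0 <= q.
  rewrite subr_ge0 ler_pdivrMr ?mul1r ?mulr_gt0 ?addr_gt0 //; lra.
pose good (u : R[i]) := sqn u = 1 /\ theta <= sqn (u - 1).
have [[u0 g0]|no] := pselect (exists u, good u); last first.
  rewrite (_ : [set w in outcomes n k | _]%SET = finset.set0) ?cards0.
    by rewrite !mulr_ge0 ?invr_ge0 ?expR_ge0 ?exprn_ge0.
  apply/setP => w; rewrite !inE; apply/negbTE; apply/nandP; right.
  by apply/negP => /asboolP[u [u1 u2 _]]; apply: no; exists u.
(* Squares without admissible points are represented by u0, so that every
   representative is admissible. *)
have /choice[rep repP] : forall c : nat * nat, exists v, good v /\
    forall u, good u -> cell K u = c -> cell K v = c.
  move=> c; have [[u [gu uc]]|nc] := pselect (exists u, good u /\ cell K u = c).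
    by exists u.
  by exists u0; split => // u gu uc; case: nc; exists u.
pose N := (2 * K).+1.
pose X (w : {set 'I_n} * 'I_n) := \sum_(c : 'I_N * 'I_N) expR sigma *
  \prod_(i < k) (1 - sqn (rep (c.1 : nat, c.2 : nat) ^+ gap w i - 1) / 8).
have phi0 c l : 0 <= 1 - sqn (rep c ^+ l - 1) / 8.
  have [[r1 _] _] := repP c; have := @sqn_unit_le4 R (rep c ^+ l).
  by rewrite sqnX r1 expr1n => /(_ erefl); lra.
have X0 w : 0 <= X w.
  by apply: sumr_ge0 => c _; rewrite mulr_ge0 ?expR_ge0 ?prodr_ge0.
have X1 w : w \in outcomes n k -> `[< exists u : R[i], [/\ sqn u = 1, theta <= sqn (u - 1) &
      \sum_(i < k) sqn (u ^+ gap w i - 1) <= tau * k%:R] >] -> 1 <= X w.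
  move=> wP /asboolP[u [u1 ut us]].
  have gu : good u by [].
  have /andP[c1 c2] := cell_lt K u1.
  have [[v1 vt] vc] := repP (cell K u).
  have {}vc := vc u gu erefl.
  rewrite /X (bigD1 (Ordinal c1, Ordinal c2)) //= ler_wpDr //.
    by apply: sumr_ge0 => c _; rewrite mulr_ge0 ?expR_ge0 ?prodr_ge0.
  set v := rep (_, _); change (sqn v = 1) in v1; change (cell K v = cell K u) in vc.
  have s4 (i : 'I_k) : 0 <= sqn (v ^+ gap w i - 1) <= 4.
    by rewrite sqn_ge0 sqn_unit_le4 // sqnX v1 expr1n.
  apply: le_trans (ler_wpM2l (expR_ge0 _) (expR_le_prod s4)).
  rewrite -expRD; apply: le_trans (expR_ge1Dx _); rewrite lerDl.
  suff : \sum_(i < k) sqn (v ^+ gap w i - 1) <= 4 * sigma by lra.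
  have B (i : 'I_k) : sqn (v ^+ gap w i - 1) <=
      2 * sqn (u ^+ gap w i - 1) + 4 * n%:R ^+ 2 / K%:R ^+ 2.
    have -> : v ^+ gap w i - 1 = (v ^+ gap w i - u ^+ gap w i) + (u ^+ gap w i - 1) by ring.
    apply: le_trans (sqnD_le _ _) _; rewrite addrC lerD2l.
    have h1 := sqnX_sub (gap w i) v1 u1.
    have h2 := cell_close K0 v1 u1 vc.
    have h3 : (gap w i)%:R ^+ 2 <= n%:R ^+ 2 :> R.
      by rewrite ler_sqr ?nnegrE // ler_nat (gap_le_n wP).
    have h4 : (gap w i)%:R ^+ 2 * sqn (v - u) <= n%:R ^+ 2 * (2 / K%:R ^+ 2).
      by apply: ler_pM => //; rewrite ?sqn_ge0 // exprn_ge0.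
    move: h4; rewrite !mulrA; lra.
  apply: le_trans (ler_sum _ (fun i _ => B i)) _.
  rewrite big_split /= -mulr_sumr sumr_const card_ord -mulr_natl /sigma.
  lra.
apply: le_trans (card_le_sum X0 X1) _.
rewrite /X exchange_big /=.
have B (c : 'I_N * 'I_N) : \sum_(w in outcomes n k) expR sigma *
    \prod_(i < k) (1 - sqn (rep (c.1 : nat, c.2 : nat) ^+ gap w i - 1) / 8) <=
    expR sigma * (n%:R / k%:R * n.+1%:R * #|outcomes n k|%:R * q ^+ k).
  set v := rep _; rewrite -mulr_sumr; apply: ler_wpM2l; first exact: expR_ge0.
  apply: le_trans (sum_prod_gaps (phi := fun _ l => 1 - sqn (v ^+ l - 1) / 8)
    k_gt0 kn (fun _ l => phi0 _ l)) _.
  apply: ler_wpM2l; first by rewrite !mulr_ge0 ?invr_ge0.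
  rewrite prodr_const card_ord lerXn2r ?nnegrE //.
    by apply: sumr_ge0 => l _; rewrite !mulr_ge0 ?exprn_ge0 ?phi0 // ltW.
  have [[v1 vt] _] := repP (c.1 : nat, c.2 : nat).
  apply: le_trans (geometric_phase n p_gt0 p_lt1 v1) _.
  rewrite lerD2l lerN2.
  rewrite -/v in vt *; move: (sqn (v - 1)) vt => d vt.
  have d0 : 0 < d by apply: lt_le_trans vt.
  rewrite ler_pdivrMr ?mulr_gt0 ?addr_gt0 // mulrAC ler_pdivlMr ?mulr_gt0 ?addr_gt0 //.
  have := ler_wpM2l (ltW p20) vt; nra.
apply: le_trans (ler_sum _ (fun c _ => B c)) _.
rewrite sumr_const card_prod !card_ord -[leLHS]mulr_natl natrM /N.
rewrite le_eqVlt; apply/orP; left; apply/eqP; ring.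
Qed.

End Bounds.

(** * From the gaps of an outcome to its spectral gap *)

(** If 1 is the only eigenvalue, B has the characteristic polynomial of the
    identity, hence its trace. *)
Lemma exists_eigenvalue_neq1 (C : numClosedFieldType) m (B : 'M[C]_m) :
  (0 < m)%N -> \tr B != m%:R -> exists2 mu, mu != 1 & eigenvalue B mu.
Proof.
move=> m0 trB; have [rs rsE] := closed_field_poly_normal (char_poly B).
move: rsE; rewrite (monicP (char_poly_monic B)) scale1r => rsE.
have [all1|] := boolP (all (pred1 1) rs); last first.
  move=> /allPn[mu mrs mu1]; exists mu => //.
  by rewrite eigenvalue_root_char rsE root_prod_XsubC.
case/eqP: trB; apply: oppr_inj; rewrite -char_poly_trace // rsE.
rewrite -(mxtrace1 C m) -char_poly_trace //; congr (polyseq _)`_ _.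
have -> : char_poly (1%:M : 'M[C]_m) = ('X - 1%:P) ^+ m.
  by rewrite /char_poly /char_poly_mx map_scalar_mx /= -raddfB det_scalar.
have srs : size rs = m.
  by apply: succn_inj; rewrite -(size_prod_XsubC rs id) -rsE size_char_poly.
rewrite (eq_big_seq (fun=> 'X - 1%:P)) => [|r /(allP all1)/eqP -> //].
by rewrite big_const_seq count_predT srs -Monoid.iteropE.
Qed.

Lemma bernoulli_ge (R : realType) (d : R) l : 0 <= d -> d <= 1 -> 1 - l%:R * d <= (1 - d) ^+ l.
Proof.
move=> d0 d1; elim: l => [|l IH]; first by rewrite mul0r subr0 expr0.
rewrite exprS -natr1; have l0 : 0 <= l%:R :> R by [].
have : (1 - d) * (1 - l%:R * d) <= (1 - d) * (1 - d) ^+ l by rewrite ler_wpM2l // subr_ge0.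
by apply: le_trans; nra.
Qed.

Section Deterministic.
Variables (R : realType) (n k : nat) (A : 'M[R]_k) (w : {set 'I_n} * 'I_n).
Variables (Delta delta omega M : R).
Hypothesis kn : (k < n)%N.
Hypothesis wP : w \in outcomes n k.
Hypothesis symA : A^T = A.
Hypothesis dsA : doubly_stochastic A.
Hypothesis irrA : irreducible_mx A.
Hypothesis gapA : Delta <= spectral_gap A.
Hypothesis Delta_gt0 : 0 < Delta.
Hypothesis Delta_le1 : Delta <= 1.
Hypothesis gapsM : forall i : 'I_k, (gap w i)%:R <= M.
Hypothesis delta_gt0 : 0 < delta.
Hypothesis Mdelta : M * delta <= 4^-1.
Hypothesis Mdelta_omega : 2 * (M * delta) <= omega * Delta.
Hypothesis omega_le : omega <= 2^-1.
Hypothesis Momega : 8 * M * omega * k%:R < n%:R.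
Hypothesis misaligned : forall u : R[i], sqn u = 1 -> (4 * M) ^- 2 <= sqn (u - 1) ->
  18 * omega * k%:R < \sum_(i < k) sqn (u ^+ gap w i - 1).

Let k_gt0 : (0 < k)%N. Proof. exact: outcome_gt0 wP. Qed.
Let gap_pos (i : 'I_k) : (0 < gap w i)%N. Proof. exact: gap_gt0 wP _ _. Qed.
Let M_ge1 : 1 <= M.
Proof. by apply: le_trans (gapsM (Ordinal k_gt0)); rewrite (ler_nat R 1). Qed.
Let delta_le : delta <= 4^-1.
Proof. by apply: le_trans Mdelta; rewrite ler_peMl // ltW. Qed.

(** The dichotomy on |u - 1|, with threshold 1 / (4 M): below it
    [twisted_eigenvalue_near1_eq1] applies, above it the phases of the gaps are
    not aligned by assumption. *)
Lemma eigenvalue_reconnected_le mu : mu != 1 ->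
  eigenvalue (map_mx (real_complex R) (reconnected_cycle A w)) mu ->
  normc mu <= 1 - delta.
Proof.
move=> mu1 /eigenvalueP[v vH v0]; rewrite leNgt; apply/negP => mud.
have mu_gt0 : 0 < normc mu by move: delta_le; lra.
have mu0 : mu != 0 by rewrite -normc_eq0 gt_eqF.
pose f (i : 'I_k) := v 0 (iter (nth n (times w) i) (@ordS n) w.2).
have relf i : \sum_j toC (A i j) * f j = mu ^+ gap w i * f (ordS i).
  exact: (eigen_gap wP vH i).
have f0 : exists i, f i != 0 by exact: (eigen_neq0 wP vH mu0 v0).
have contr h (h0 : \sum_i h i = 0) :=
  gap_contraction symA dsA irrA gapA h0.
have mule1 : normc mu <= 1.
  exact: (twisted_eigenvalue_le1 k_gt0 dsA contr (@ordS_inj k) gap_pos Delta_gt0 relf f0).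
have eps0 : 0 <= M * delta by rewrite mulr_ge0 // ltW // (lt_le_trans _ M_ge1).
have eps1 : M * delta <= 1 by move: Mdelta; lra.
have ell_eps (i : 'I_k) : 1 - M * delta <= normc (mu ^+ gap w i).
  rewrite normcX; apply: (@le_trans _ _ ((1 - delta) ^+ gap w i)).
    apply: le_trans (bernoulli_ge _ (ltW delta_gt0) _); last by move: delta_le; lra.
    by rewrite lerD2l lerN2 ler_wpM2r // ltW.
  by rewrite lerXn2r ?nnegrE ?normc_ge0 ?ltW //; move: delta_le; lra.
have [g [g0 gs relg]] := twisted_eigenvector_near_constant k_gt0 dsA contr (@ordS_inj k) Delta_gt0
  relf f0 eps0 eps1 ell_eps Mdelta_omega omega_le.
pose u := mu / toC (normc mu).
have C0 : toC (normc mu) != 0 by rewrite fmorph_eq0 gt_eqF.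
have muE : mu = toC (normc mu) * u by rewrite /u mulrC divfK.
have u1 : sqn u = 1.
  have nz : normc mu ^+ 2 != 0 by rewrite expf_neq0 // gt_eqF.
  by apply: (mulfI nz); rewrite mulr1 -sqn_toC -sqnM -muE sqn_toC sqn_normc.
have phases := unit_phases_near1 contr (@ordS_inj k) Delta_gt0 Delta_le1 g0 gs relg mule1
  muE u1 eps0 eps1 ell_eps Mdelta_omega.
have [far|near] := leP ((4 * M) ^- 2) (sqn (u - 1)).
  by have := misaligned u1 far; rewrite ltNge phases.
have M0 : 0 < M by exact: lt_le_trans M_ge1.
have near' : normc (mu - 1) <= delta + (4 * M)^-1.
  have -> : mu - 1 = toC (normc mu - 1) * u + (u - 1).
    by rewrite {1}muE rmorphB rmorph1; ring.
  apply: le_trans (normcD_le _ _) _; apply: lerD.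
    have -> : toC (normc mu - 1) * u = - (toC (1 - normc mu) * u).
      by rewrite -mulNr -rmorphN opprB.
    rewrite normc_neg normcM normc_toC; last by move: mule1; lra.
    have -> : normc u = 1 by apply/eqP; rewrite -sqrp_eq1 ?normc_ge0 // -sqn_normc u1.
    by move: mud; lra.
  have M00 := ltW M0; rewrite -ler_sqr ?nnegrE ?normc_ge0 ?invr_ge0 ?mulr_ge0 //.
  by rewrite -sqn_normc exprVn; exact: ltW.
have Mk : M * (delta + (4 * M)^-1) <= 2^-1.
  have -> : M * (delta + (4 * M)^-1) = M * delta + 4^-1 by field; rewrite gt_eqF.
  by move: Mdelta; lra.
have := twisted_eigenvalue_near1_eq1 k_gt0 dsA (@ordS_inj k) gap_pos g0 gs relg mule1 near' gapsM Mk
  (sum_gap wP) Momega.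
by move/eqP: mu1.
Qed.

Lemma spectral_gap_reconnected_ge : delta <= spectral_gap (reconnected_cycle A w).
Proof.
apply: lb_le_inf.
  have n_gt0 : (0 < n)%N by exact: leq_ltn_trans kn.
  have [|mu mu1 ev] := @exists_eigenvalue_neq1 _ _ (map_mx (real_complex R)
    (reconnected_cycle A w)) n_gt0.
    rewrite trace_map_mx -[n%:R](rmorph_nat (real_complex R)) (inj_eq (@complexI R)).
    by rewrite lt_eqF // trace_reconnected_lt.
  by exists (1 - normc mu); exists mu.
move=> _ [mu [mu1 ev ->]].
by have := eigenvalue_reconnected_le mu1 ev; lra.
Qed.

End Deterministic.

(** * Explicit failure probability *)

Section ProbabilityBound.
Variables (R : realType) (n k : nat) (A : 'M[R]_k).
Hypothesis k_gt0 : (0 < k)%N.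
Hypothesis kn : (k < n)%N.

Let outcomes_gt0 : 0 < #|outcomes n k|%:R :> R.
Proof. by rewrite ltr0n card_outcomes muln_gt0 k_gt0 bin_gt0 ltnW. Qed.

Lemma prob_le1 (E : pred ({set 'I_n} * 'I_n)) : prob R k E <= 1.
Proof.
rewrite ler_pdivrMr // mul1r ler_nat; apply: subset_leq_card.
by apply/fintype.subsetP => w; rewrite inE => /andP[].
Qed.

(** Outside the two rare events the deterministic bound applies. *)
Lemma prob_spectral_gap_ge (Delta delta omega M : R) (K : nat)
    (p := k%:R / n%:R : R) (theta := (4 * M) ^- 2) :
  A^T = A -> doubly_stochastic A -> irreducible_mx A -> Delta <= spectral_gap A ->
  0 < Delta -> Delta <= 1 -> 0 < delta -> 0 < M -> M * delta <= 4^-1 ->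
  2 * (M * delta) <= omega * Delta -> omega <= 2^-1 ->
  8 * M * omega * k%:R < n%:R -> (0 < K)%N ->
  1 - n%:R * n.+1%:R * (1 - p) ^+ Num.truncn M
    - (2 * K).+1%:R ^+ 2 * (n%:R / k%:R * n.+1%:R)
      * expR ((2 * (18 * omega) + 4 * n%:R ^+ 2 / K%:R ^+ 2) * k%:R / 4)
      * (1 - theta / (8 * (p ^+ 2 + theta))) ^+ k
  <= prob R k (fun w : {set 'I_n} * 'I_n => delta <= spectral_gap (reconnected_cycle A w)).
Proof.
move=> symA dsA irrA gapA D0 D1 d0 M0 Md Mdo o2 Mo K0.
have th0 : 0 < theta by rewrite invr_gt0 exprn_gt0 // mulr_gt0.
rewrite ler_pdivlMr //.
have long := @card_long_gap R n k k_gt0 kn (Num.truncn M).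
have aligned := card_aligned_phases k_gt0 kn (18 * omega) K0 th0.
rewrite !mulrBl mul1r.
set good := [set w in _ | _]%SET.
set S1 := [set w in _ | _]%SET in long; set S2 := [set w in _ | _]%SET in aligned.
suff : #|outcomes n k|%:R <= #|good|%:R + #|S1|%:R + #|S2|%:R :> R.
  by move: long aligned; rewrite -/p; lra.
rewrite -!natrD ler_nat.
apply: (@leq_trans #|(good :|: S1) :|: S2|); last first.
  by rewrite (leq_trans (leq_card_setU _ _)) // leq_add2r leq_card_setU.
apply: subset_leq_card; apply/fintype.subsetP => w wP.
have E0 (E : pred ({set 'I_n} * 'I_n)) : (w \in [set w in outcomes n k | E w]%SET) = E w.
  by rewrite finset.in_set wP.
rewrite !finset.in_setU !E0.
have [al|nal] := pselect (exists u : R[i], [/\ sqn u = 1, theta <= sqn (u - 1) &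
    \sum_(i < k) sqn (u ^+ gap w i - 1) <= 18 * omega * k%:R]).
  by apply/orP; right; apply/boolp.asboolP.
apply/orP; left; apply/orP.
have [lg|nlg] := boolP [exists i : 'I_k, (Num.truncn M < gap w i)%N]; [by right|left].
apply: (spectral_gap_reconnected_ge (M := M) (omega := omega) (Delta := Delta)) => //.
- move=> i; move: nlg; rewrite negb_exists => /forallP/(_ i); rewrite -leqNgt => h.
  by apply: le_trans (_ : (Num.truncn M)%:R <= _); rewrite ?ler_nat // truncn_le ltW.
- by move=> u u1 ut; rewrite ltNge; apply/negP => us; apply: nal; exists u.
Qed.

End ProbabilityBound.

Section Quantitative.
Variables (R : realType) (rho_u c alpha gamma : R).
Hypothesis rho1 : 1 < rho_u.
Hypothesis c_gt0 : 0 < c.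
Hypothesis alpha_ge0 : 0 <= alpha.
Hypothesis gamma_gt : 7 + alpha < gamma.

Let c0 := c / (1 + c).
Let c0_gt0 : 0 < c0. Proof. by rewrite divr_gt0 // addr_gt0. Qed.
Let c0_le1 : c0 <= 1. Proof. by rewrite ler_pdivrMr ?addr_gt0 // mul1r lerDr. Qed.
Let c0_lec : c0 <= c.
Proof. by rewrite ler_pdivrMr ?addr_gt0 // mulrDr mulr1 lerDl mulr_ge0 // ltW. Qed.

(** How large ln k must be. The constants come from 136 = 8 * 17 in the mean of
    the phases, halved twice (272, then 544) to make room for the two error
    terms of the exponent, and from 720 = 6! in exp L >= L ^ 6 / 6!. The factor
    c / (1 + c) stands for c in the spectral gap, so that it is also at most
    1. *)
Definition log_threshold : R := (18 * 544) / (c / (1 + c)) + (720 * 272) * (6 * rho_u + 1).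

Section FixedSize.
Variables (n k : nat) (A : 'M[R]_k).
Hypothesis gcA : gap_class c alpha A.
Hypothesis k_gt1 : (1 < k)%N.
Hypothesis kn : (k < n)%N.
Local Notation L := (ln (k%:R : R)).
Hypothesis n_le : ln (n%:R : R) <= rho_u * L.
Hypothesis L_large : log_threshold <= L.

Let k_gt0 : (0 < k)%N. Proof. exact: ltnW. Qed.
Let kR : 0 < k%:R :> R. Proof. by rewrite ltr0n. Qed.
Let nR : 0 < n%:R :> R. Proof. by rewrite ltr0n (leq_trans _ kn). Qed.

Let Lc : (18 * 544) <= c0 * L.
Proof.
have h : (18 * 544) / c0 <= L.
  apply: le_trans L_large; rewrite /log_threshold -/c0 lerDl.
  by move: rho1; lra.
by rewrite [c0 * L]mulrC -ler_pdivrMr.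
Qed.
Let Lrho : (720 * 272) * (6 * rho_u + 1) <= L.
Proof.
apply: le_trans L_large; rewrite /log_threshold -/c0 lerDr.
by apply: divr_ge0; [lra|exact: ltW].
Qed.
Let L_big : (720 * 544) <= L. Proof. by move: Lrho rho1; lra. Qed.
Let L_gt0 : 0 < L. Proof. by move: L_big; lra. Qed.
Let L_ge1 : 1 <= L. Proof. by move: L_big; lra. Qed.

Let p : R := k%:R / n%:R.
Let M : R := n%:R / k%:R * L ^+ 2.
Let delta : R := k%:R / (n%:R * L `^ gamma).
Let Delta : R := c0 * L `^ (- alpha).
Let omega : R := 2 * (M * delta) / Delta.

Let G_gt0 : 0 < L `^ gamma. Proof. exact: powR_gt0. Qed.
Let a_gt0 : 0 < L `^ alpha. Proof. exact: powR_gt0. Qed.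
Let a_ge1 : 1 <= L `^ alpha.
Proof. by have := ler_powR L_ge1 alpha_ge0; rewrite powRr0. Qed.
(** All that the estimates below use of gamma > 7 + alpha. *)
Let G_ge : L ^+ 7 * L `^ alpha <= L `^ gamma.
Proof.
rewrite -powR_mulrn ?(ltW L_gt0) // -powRD; last by apply/implyP => _; rewrite gt_eqF.
by apply: (ler_powR L_ge1); exact: ltW.
Qed.
Let DeltaE : Delta = c0 / L `^ alpha. Proof. by rewrite /Delta powRN. Qed.
Let Delta_gt0 : 0 < Delta. Proof. by rewrite DeltaE divr_gt0. Qed.
Let MdE : M * delta = L ^+ 2 / L `^ gamma.
Proof. by rewrite /M /delta; field; rewrite !gt_eqF. Qed.

Let Md_le : M * delta <= (L ^+ 5)^-1.
Proof.
rewrite MdE ler_pdivrMr // mulrC ler_pdivlMr ?exprn_gt0 //.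
apply: le_trans G_ge; rewrite -exprD; apply: ler_peMr => //.
by rewrite exprn_ge0 // ltW.
Qed.

Let omega_le : omega <= 2 / (c0 * L ^+ 5).
Proof.
rewrite /omega MdE DeltaE.
have -> : 2 * (L ^+ 2 / L `^ gamma) / (c0 / L `^ alpha) =
   2 * (L ^+ 2 * L `^ alpha) / (c0 * L `^ gamma) by field; rewrite !gt_eqF.
have -> : 2 / (c0 * L ^+ 5) = 2 * (L ^+ 2 * L `^ alpha) / (c0 * (L ^+ 7 * L `^ alpha)).
  by field; rewrite !gt_eqF.
have L7 : 0 < L ^+ 7 * L `^ alpha by rewrite mulr_gt0 // exprn_gt0.
apply: ler_wpM2l; first by rewrite !mulr_ge0 ?exprn_ge0 // ltW.
by rewrite lef_pV2 ?posrE ?ler_pM2l // mulr_gt0.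
Qed.

Let omega_ge0 : 0 <= omega.
Proof. by rewrite /omega MdE !mulr_ge0 ?invr_ge0 ?exprn_ge0 // ltW. Qed.

Let omega_L4 : 9 * omega * L ^+ 4 <= 544^-1.
Proof.
have : omega * (c0 * L ^+ 5) <= 2.
  by rewrite -ler_pdivlMr ?omega_le // mulr_gt0 // exprn_gt0.
have o4 : 0 <= omega * L ^+ 4 by rewrite mulr_ge0 // exprn_ge0 // ltW.
have := ler_wpM2l o4 Lc.
have -> : omega * L ^+ 4 * (c0 * L) = omega * (c0 * L ^+ 5) by ring.
lra.
Qed.

Let k_ge : L ^+ 6 / 720 <= k%:R.
Proof.
rewrite -[leRHS](@lnK R) //.
apply: le_trans (expR_ge1Dxn 5 (ltW L_gt0)).
by rewrite (_ : 6`! = 720)%N // lerDr.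
Qed.

Let n_exp : n%:R <= expR (rho_u * L).
Proof. by rewrite -[leLHS](@lnK R) // ler_expR. Qed.

Let kn_le : k%:R <= n%:R :> R. Proof. by rewrite ler_nat ltnW. Qed.
Let p_le1 : p <= 1. Proof. by rewrite ler_pdivrMr // mul1r. Qed.
Let p_gt0 : 0 < p. Proof. by rewrite divr_gt0. Qed.
Let n_ge1 : 1 <= n%:R :> R. Proof. by rewrite (ler_nat R 1) (leq_trans _ kn). Qed.

Let M_gt0 : 0 < M. Proof. by rewrite mulr_gt0 ?exprn_gt0 ?divr_gt0. Qed.

(** Once L is large the quadratic term wins: a L - b L ^ 2 <= - L = - ln k. *)
Let expR_small (a b : R) : 0 <= a -> a <= 6 * rho_u -> 1 <= 720 * 272 * b ->
  expR (a * L - b * L ^+ 2) <= k%:R^-1.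
Proof.
move=> a0 a6 b0; have -> : k%:R^-1 = expR (- L) by rewrite expRN lnK.
rewrite ler_expR.
have h1 : 6 * rho_u + 1 <= b * L.
  by have := ler_wpM2r (ltW L_gt0) b0; move: Lrho; lra.
have := ler_wpM2l (ltW L_gt0) h1; have := ler_wpM2l (ltW L_gt0) a6.
lra.
Qed.

Let rho2_ge0 : 0 <= 2 * rho_u. Proof. by move: rho1; lra. Qed.
Let rho6_ge0 : 0 <= 6 * rho_u. Proof. by move: rho1; lra. Qed.
Let rho2_le : 2 * rho_u <= 6 * rho_u. Proof. by move: rho1; lra. Qed.

Let err_long : n%:R * n.+1%:R * (1 - p) ^+ Num.truncn M <= 2 * expR 1 / k%:R.
Proof.
have x0 : 0 <= 1 - p by rewrite subr_ge0.
have n1 : n.+1%:R <= 2 * n%:R :> R by rewrite -natr1; move: n_ge1; lra.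
have e1 : (1 - p) ^+ Num.truncn M <= expR 1 * expR (- L ^+ 2).
  apply: (@le_trans _ _ (expR (- p) ^+ Num.truncn M)).
    by rewrite lerXn2r ?nnegrE ?expR_ge0 // expR_ge1Dx.
  rewrite -expRM_natl -expRD ler_expR.
  have /andP[_] := truncn_itv (ltW M_gt0); rewrite -natr1 => Mt.
  have pM : p * M = L ^+ 2 by rewrite /p /M; field; rewrite !gt_eqF.
  have := ler_wpM2l (ltW p_gt0) (ltW Mt); rewrite pM; move: p_le1; lra.
have nn : n%:R * n.+1%:R <= 2 * expR (2 * rho_u * L) :> R.
  apply: (@le_trans _ _ (2 * (n%:R * n%:R))).
    by rewrite mulrCA ler_wpM2l.
  rewrite ler_wpM2l // -mulrA mulr2n mulrDl !mul1r expRD.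
  by apply: ler_pM.
apply: (@le_trans _ _ (2 * expR (2 * rho_u * L) * (expR 1 * expR (- L ^+ 2)))).
  by apply: ler_pM; rewrite ?mulr_ge0 ?exprn_ge0.
have -> : 2 * expR (2 * rho_u * L) * (expR 1 * expR (- L ^+ 2)) =
   2 * expR 1 * expR (2 * rho_u * L - 1 * L ^+ 2).
  by rewrite mul1r expRD; ring.
rewrite ler_pM2l ?mulr_gt0 ?expR_gt0 //.
apply: expR_small; [exact: rho2_ge0|exact: rho2_le|].
by rewrite mulr1 mulr_ege1 // ler1n.
Qed.

Let theta : R := (4 * M) ^- 2.

(** theta = |u - 1| ^ 2 at the threshold 1 / (4 M) equals p ^ 2 / (16 L ^ 4). *)
Let phase_rate : (136 * L ^+ 4)^-1 <= theta / (8 * (p ^+ 2 + theta)).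
Proof.
have -> : theta / (8 * (p ^+ 2 + theta)) = (8 * (16 * L ^+ 4 + 1))^-1.
  have pM : p = L ^+ 2 / M by rewrite /p /M; field; rewrite !gt_eqF.
  have Mn0 : M != 0 by rewrite gt_eqF.
  have L40 : 0 <= L ^+ 4 by rewrite exprn_ge0 // ltW.
  have h : 8 * (16 * L ^+ 4 + 1) != 0 by rewrite gt_eqF //; lra.
  rewrite /theta pM; move: (M) Mn0 => M' Mn0.
  by field; rewrite Mn0 /= gt_eqF //; lra.
have L41 : 1 <= L ^+ 4 by rewrite exprn_ege1.
have d1 : 0 < 8 * (16 * L ^+ 4 + 1) by lra.
have d2 : 0 < 136 * L ^+ 4 by lra.
by rewrite lef_pV2 ?posrE //; lra.
Qed.

Let err_phase :
  (2 * (n ^ 2)).+1%:R ^+ 2 * (n%:R / k%:R * n.+1%:R)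
      * expR ((2 * (18 * omega) + 4 * n%:R ^+ 2 / (n ^ 2)%N%:R ^+ 2) * k%:R / 4)
      * (1 - theta / (8 * (p ^+ 2 + theta))) ^+ k <= 18 / k%:R.
Proof.
have L41 : 1 <= L ^+ 4 by rewrite exprn_ege1.
have L4 : 0 < L ^+ 4 by rewrite exprn_gt0.
have n1 : n.+1%:R <= 2 * n%:R :> R by rewrite -natr1; move: n_ge1; lra.
have n21 : 1 <= n%:R ^+ 2 :> R by rewrite exprn_ege1.
have c1 : (2 * (n ^ 2)).+1%:R ^+ 2 <= 9 * n%:R ^+ 4 :> R.
  rewrite -natr1 natrM natrX.
  have -> : 9 * n%:R ^+ 4 = (3 * n%:R ^+ 2) ^+ 2 :> R by ring.
  by rewrite ler_sqr ?nnegrE ?addr_ge0 ?mulr_ge0 ?exprn_ge0 //; lra.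
have c2 : n%:R / k%:R * n.+1%:R <= 2 * n%:R ^+ 2 :> R.
  have : n%:R / k%:R <= n%:R :> R by rewrite ler_pdivrMr // ler_peMr // (ler_nat R 1).
  by move=> h; apply: le_trans (ler_pM _ _ h n1) _; rewrite ?divr_ge0 //; lra.
have th0 : 0 < theta by rewrite invr_gt0 exprn_gt0 // mulr_gt0.
have p20 : 0 < p ^+ 2 by rewrite exprn_gt0.
have rate := phase_rate; set q := theta / _ in rate *.
have q1 : q <= 1 by rewrite ler_pdivrMr ?mul1r ?mulr_gt0 ?addr_gt0 //; lra.
have c4 : (1 - q) ^+ k <= expR (- (k%:R / (136 * L ^+ 4))).
  apply: (@le_trans _ _ (expR (- q) ^+ k)).
    by rewrite lerXn2r ?nnegrE ?expR_ge0 ?subr_ge0 // expR_ge1Dx.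
  by rewrite -expRM_natl ler_expR mulrN lerN2 ler_wpM2l.
have nk : (n%:R ^+ 2)^-1 * L ^+ 4 <= 544^-1 :> R.
  have k4 : 544 * L ^+ 4 <= k%:R.
    have L2 : 720 * 544 <= L ^+ 2.
      by apply: le_trans L_big _; rewrite expr2 ler_peMr // ltW.
    have := ler_wpM2l (ltW L4) L2; rewrite -exprD => L6.
    by apply: le_trans k_ge; move: L6; rewrite (_ : (4 + 2)%N = 6%N) //; lra.
  rewrite mulrC ler_pdivrMr ?exprn_gt0 //.
  have : k%:R <= n%:R ^+ 2 :> R.
    by apply: le_trans kn_le _; rewrite expr2 ler_peMr.
  by lra.
have c3 : (2 * (18 * omega) + 4 * n%:R ^+ 2 / (n ^ 2)%N%:R ^+ 2) * k%:R / 4 <=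
    k%:R / (272 * L ^+ 4).
  have -> : (2 * (18 * omega) + 4 * n%:R ^+ 2 / (n ^ 2)%N%:R ^+ 2) * k%:R / 4 =
     k%:R * (9 * omega + (n%:R ^+ 2)^-1).
    by rewrite natrX; field; rewrite gt_eqF.
  have d2 : 0 < 272 * L ^+ 4 by lra.
  rewrite (ler_pM2l kR) -[leRHS]mul1r (ler_pdivlMr _ _ d2).
  by move: omega_L4; lra.
have n6 : n%:R ^+ 6 <= expR (6 * rho_u * L) :> R.
  rewrite -mulrA expRM_natl lerXn2r ?nnegrE ?expR_ge0 //.
apply: (@le_trans _ _ (18 * expR (6 * rho_u * L) *
    (expR (k%:R / (272 * L ^+ 4)) * expR (- (k%:R / (136 * L ^+ 4)))))).
  rewrite -mulrA; apply: ler_pM.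
  - by rewrite !mulr_ge0 ?exprn_ge0 ?invr_ge0.
  - by rewrite mulr_ge0 ?expR_ge0 ?exprn_ge0 ?subr_ge0.
  - apply: le_trans (ler_pM _ _ c1 c2) _; rewrite ?exprn_ge0 ?mulr_ge0 ?invr_ge0 //.
    have -> : 9 * n%:R ^+ 4 * (2 * n%:R ^+ 2) = 18 * n%:R ^+ 6 :> R by ring.
    by rewrite ler_wpM2l.
  - by apply: ler_pM; rewrite ?expR_ge0 ?exprn_ge0 ?subr_ge0 // ler_expR.
rewrite -mulrA ler_pM2l // -!expRD.
apply: (le_trans _ (expR_small (b := 720^-1 * 272^-1) _ (lexx _) _)); last 2 first.
- exact: rho6_ge0.
- by rewrite mulrACA !divff ?mulr1 ?pnatr_eq0.
rewrite ler_expR lerD2l.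
have -> : k%:R / (272 * L ^+ 4) + - (k%:R / (136 * L ^+ 4)) = - (k%:R / (272 * L ^+ 4)).
  by field; rewrite gt_eqF.
have d2 : 0 < 272 * L ^+ 4 by lra.
rewrite lerN2 (ler_pdivlMr _ _ d2).
have -> : 720^-1 * 272^-1 * L ^+ 2 * (272 * L ^+ 4) = L ^+ 6 / 720 by field.
exact: k_ge.
Qed.

(** Each rare event has probability at most a constant times 1 / k. *)
Lemma prob_spectral_gap_ge_log : 1 - (2 * expR 1 + 18) / k%:R <=
  prob R k (fun w : {set 'I_n} * 'I_n =>
    k%:R / (n%:R * L `^ gamma) <= spectral_gap (reconnected_cycle A w)).
Proof.
have [symA dsA irrA gapA] := gcA.
have L5 : 4 <= L ^+ 5.
  have : L ^+ 1 <= L ^+ 5 by rewrite ler_weXn2l.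
  by rewrite expr1; move: L_big; lra.
have L50 : 0 < L ^+ 5 by rewrite exprn_gt0.
have L41 : 1 <= L ^+ 4 by rewrite exprn_ege1.
have L2 : L ^+ 2 <= L ^+ 4 by rewrite ler_weXn2l.
have oL4 : omega <= omega * L ^+ 4 by rewrite ler_peMr.
have oL2 : omega * L ^+ 2 <= omega * L ^+ 4 by rewrite ler_wpM2l.
apply: (le_trans _ (@prob_spectral_gap_ge R n k A k_gt0 kn Delta delta omega M (n ^ 2)
  symA dsA irrA _ Delta_gt0 _ _ M_gt0 _ _ _ _ _)).
- rewrite mulrDl opprD addrA; apply: lerB; last exact: err_phase.
  by apply: lerB; last exact: err_long.
- by apply: le_trans gapA; rewrite /Delta ler_wpM2r // powR_ge0.
- by rewrite DeltaE ler_pdivrMr // mul1r (le_trans c0_le1).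
- by rewrite divr_gt0 // mulr_gt0.
- by apply: le_trans Md_le _; rewrite lef_pV2 ?posrE.
- by rewrite /omega divfK // gt_eqF.
- by move: omega_L4; lra.
- have -> : 8 * M * omega * k%:R = n%:R * (8 * (omega * L ^+ 2)).
    by rewrite /M; field; rewrite gt_eqF.
  by rewrite gtr_pMr //; move: omega_L4; lra.
- by rewrite expn_gt0 (leq_trans _ kn).
Qed.

End FixedSize.
End Quantitative.

(** * Convergence *)

Theorem theorem6 (R : realType) (rho_l rho_u c alpha gamma : R)
    (h_l : 1 < rho_l) (h_lu : rho_l < rho_u)
    (hc : 0 < c) (halpha : 0 <= alpha) (hgamma : 7 + alpha < gamma)
    (A : forall k : nat, 'M[R]_k)
    (n k : nat -> nat)
    (hn : n @ \oo --> \oo) (hk : k @ \oo --> \oo)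
    (hnk : forall m : nat, rho_l < ln (n m)%:R / ln (k m)%:R < rho_u)
    (hA : forall m : nat, gap_class c alpha (A (k m))) :
  (fun m : nat =>
     prob R (k m) (fun w : {set 'I_(n m)} * 'I_(n m) =>
       (k m)%:R / ((n m)%:R * ln (k m)%:R `^ gamma)
         <= spectral_gap (reconnected_cycle (A (k m)) w)))
    @ \oo --> (1 : R).
Proof.
have rho1 : 1 < rho_u by apply: lt_trans h_lu.
have kinv : ((k m)%:R^-1 : R) @[m --> \oo] --> (0 : R).
  apply/cvgrPdist_lt => e e0.
  have := hk; move=> /cvgnyPge /(_ (Num.truncn e^-1).+1).
  apply: filterS => m km.
  have km0 : 0 < (k m)%:R :> R by rewrite ltr0n (leq_trans _ km).
  rewrite sub0r normrN ger0_norm ?invr_ge0 // invf_plt ?posrE //.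
  have ei : 0 <= e^-1 by rewrite invr_ge0 ltW.
  have /andP[_ h] := truncn_itv ei.
  by apply: lt_le_trans h _; rewrite ler_nat.
have low : (1 - (2 * expR 1 + 18) / (k m)%:R : R) @[m --> \oo] --> (1 : R).
  rewrite -[X in _ --> X]subr0 -(mulr0 (2 * expR 1 + 18)).
  by apply: cvgB; [exact: cvg_cst|apply: cvgM => //; exact: cvg_cst].
apply: squeeze_cvgr low (cvg_cst (1 : R)).
have := hk; move=> /cvgnyPge /(_ (Num.truncn (expR (log_threshold rho_u c))).+1).
apply: filterS => m km.
have L0 : 0 < log_threshold rho_u c.
  have c0 : 0 < c / (1 + c) by rewrite divr_gt0 // addr_gt0.
  by apply: addr_gt0; [apply: divr_gt0; [lra|exact: c0]|lra].
have Lk : log_threshold rho_u c <= ln (k m)%:R.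
  have /andP[_ h] := truncn_itv (expR_ge0 (log_threshold rho_u c)).
  have h2 : expR (log_threshold rho_u c) <= (k m)%:R.
    by apply: le_trans (ltW h) _; rewrite ler_nat.
  rewrite -ler_expR lnK //; exact: lt_le_trans (expR_gt0 _) h2.
have lnk0 : 0 < ln (k m)%:R :> R by apply: lt_le_trans Lk.
have k1 : (1 < k m)%N.
  rewrite ltnNge; apply/negP => kle.
  have : ln ((k m)%:R : R) <= 0 by apply: ln_le0; rewrite (ler_nat R _ 1).
  by rewrite leNgt lnk0.
have /andP[hl hu] := hnk m.
have nl : ln (k m)%:R < ln (n m)%:R :> R.
  move: hl; rewrite ltr_pdivlMr //; apply: le_lt_trans.
  by rewrite ler_peMl // ltW.
have n0 : 0 < (n m)%:R :> R.
  rewrite ltr0n lt0n; apply/negP => /eqP n0; move: nl; rewrite n0.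
  have : ln (0%:R : R) <= 0 by apply: ln_le0.
  by move=> /(lt_le_trans) h /h; rewrite ltNge ltW.
have kn : (k m < n m)%N.
  by rewrite -(ltr_nat R) -ltr_ln ?posrE // ltr0n ltnW.
apply/andP; split; last exact: prob_le1 (ltnW k1) kn _.
apply: (prob_spectral_gap_ge_log rho1 hc halpha hgamma (hA m) k1 kn _ Lk).
by move: hu; rewrite ltr_pdivrMr // => /ltW.
Qed.
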